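(* Let $n\ge1$ and suppose $\alpha,\lambda,\sigma$ are constants with $\alpha\in(0,n+2)$, $0<\lambda<\frac{n+2}{n}$, and $\sigma>\frac{2(n+2)-\alpha}{n}-\lambda$. Let $\varphi:(0,1)\to(0,\infty)$ be continuous with $\lim_{t\to0^+}\varphi(t)=\infty$. Then there exists a positive function $u\in C^\infty(\mathbb{R}^n\times(0,1))\cap L^\lambda(\mathbb{R}^n\times(0,1))$ satisfying $$0\le u_t-\Delta u\le \Big(\iint_{\mathbb{R}^n\times(0,1)}\Phi(x-y,t-s)^{\alpha/n}u(y,s)^\lambda\,dy\,ds\Big)\,u(x,t)^\sigma\quad\text{in }\mathbb{R}^n\times(0,1)$$ such that $u(0,t)\ne O(\varphi(t))$ as $t\to0^+$.
   Context: $\Phi$ is the heat kernel: $\Phi(x,t)=(4\pi t)^{-n/2}e^{-|x|^2/(4t)}$ for $t>0$ and $\Phi(x,t)=0$ for $t\le0$. *)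

(* Defs.v *)
From HB Require Import structures.
From mathcomp Require Import all_boot all_order all_algebra.
From mathcomp Require Import all_classical all_reals all_analysis.
Set Implicit Arguments. Unset Strict Implicit. Unset Printing Implicit Defensive.
Import Order.TTheory GRing.Theory Num.Theory.
Import numFieldNormedType.Exports.
Local Open Scope classical_set_scope.
Local Open Scope ring_scope.

Section Defs.
Variable R : realType.

Fixpoint iter_der {V W : normedModType R} (vs : seq V) (f : V -> W) : V -> W :=
  match vs with
  | [::] => f
  | v :: vs' => fun x => 'D_v (iter_der vs' f) x
  end.

Definition smooth_on {V W : normedModType R} (U : set V) (f : V -> W) : Prop :=
  forall vs : seq V,
    {within U, continuous (iter_der vs f)} /\
    (forall v x, U x -> derivable (iter_der vs f) x v).

Definition strip (n : nat) : set ('rV[R]_n * R) :=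
  [set p | 0 < p.2 < 1].

Definition evec (n : nat) (i : 'I_n) : 'rV[R]_n := delta_mx 0 i.

Definition heat_op (n : nat) (U : 'rV[R]_n * R -> R) (p : 'rV[R]_n * R) : R :=
  'D_((0 : 'rV[R]_n), (1 : R)) U p
  - \sum_(i < n) 'D_(evec i, (0 : R)) ('D_(evec i, (0 : R)) U) p.

Definition sqnorm (n : nat) (x : 'rV[R]_n) : R := \sum_(i < n) (x 0 i) ^+ 2.

Definition heat_kernel (n : nat) (x : 'rV[R]_n) (t : R) : R :=
  if 0 < t then
    ((4 * pi * t) `^ (- (n%:R / 2))) * expR (- (sqnorm x / (4 * t)))
  else 0.

(* Lebesgue integral over R^n of a function with values in \bar R,
   as an iterated integral of one-dimensional Lebesgue integrals
   (coordinates x_0, x_1, ..., x_{n-1}); only applied to nonnegative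
   integrands, for which it coincides with the n-dimensional Lebesgue
   integral by Tonelli. *)
Fixpoint integral_Rn (n : nat) : ('rV[R]_n -> \bar R) -> \bar R :=
  match n return ('rV[R]_n -> \bar R) -> \bar R with
  | 0 => fun f => f 0
  | n'.+1 => fun f =>
      (\int[@lebesgue_measure R]_(c in [set: R])
         integral_Rn (fun v : 'rV[R]_n' =>
                        f (row_mx (const_mx c : 'rV[R]_1) v)))%E
  end.

Definition integral_strip (n : nat) (f : 'rV[R]_n -> R -> \bar R) : \bar R :=
  (\int[@lebesgue_measure R]_(s in `]0%R, 1%R[%classic)
      integral_Rn (fun y => f y s))%E.

End Defs.

(* Main.v *)
Require Import Defs.
From HB Require Import structures.
From mathcomp Require Import all_boot all_order all_algebra.
From mathcomp Require Import all_classical all_reals all_analysis.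
From mathcomp Require Import measurable_realfun.
From mathcomp Require Import ring lra.
Set Implicit Arguments. Unset Strict Implicit. Unset Printing Implicit Defensive.
Import Order.TTheory GRing.Theory Num.Theory.
Import numFieldNormedType.Exports.
Local Open Scope classical_set_scope.
Local Open Scope ring_scope.

(** A term [m * step((t - T) / r^2 + 4) * Phi(x, t - T + 5 r^2)] is a heat kernel
that is switched on during the time window [(T - 4 r^2, T - 3 r^2)]; its heat operator
is [m * step' / r^2 * Phi >= 0], supported in that window.  Chain such terms towards
the apex [(0, T)] with radii [r] decreasing by a fixed factor [q] and masses [r^ep].
While a term is being switched on, the previous one is fully on and bounds both [u]
and the convolution [Phi^(alpha/n) * u^lambda] from below on the parabolic scale [r];
as [q] is small its Gaussian is wide enough to dominate that of the source at every
[x], and the powers of [r] compare favourably exactly because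
[n (lambda + sigma) > 2 (n + 2) - alpha].  The height [r^(ep - n)] reached at [(0, T)]
is unbounded in the number of terms, so it can be made to beat [phi T].  The solution
[u] is the sum of such chains with apex times [T_j] decreasing geometrically to 0; the
windows are pairwise disjoint, so at most one source is active at a time, and the
smallness of the masses gives both smoothness and membership in [L^lambda]. *)

(** * Functions of class C^k in terms of iterated directional derivatives *)

(** Scale count for a term of radius r. Its source has size r^(ep-2-n). On a parabolic box of volume
    r^(n+2) the previous term makes the convolution at least of size r^(-alpha) r^((ep-n) lambda)
    r^(n+2), and u^sigma at least of size r^((ep-n) sigma). Up to constants the inequality says r^E
    <= 1 with E = ep - 4 - 2n + alpha + (n-ep)(lambda+sigma). At ep = 0 the condition E > 0 is the
    hypothesis on sigma; a small ep > 0 keeps it and makes the masses summable, while ep < n keeps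
    the heights unbounded. Once E > 0, a small first radius [r0] absorbs all constants. These
    comparisons are made between exponents of [expR], where they are linear. The nonlinear
    right-hand side calls only for lower bounds on u, and any single term of the series provides
    one. The chain lengths [K] are the only data depending on [phi], and nothing bounds them; the
    radii therefore decay geometrically in both indices, so that masses and integrals are summed
    uniformly in [K]. The bound lambda < (n+2)/n enters through time integrals of t^(n(1-lambda)/2),
    whose exponent must exceed -1. *)

Section ck.
Context {R : realType} {V : normedModType R}.
Implicit Types (U : set V) (f g : V -> R).

(** Only directional derivatives occur, as in [smooth_on], so closure properties are inductions on
    the order. Continuity is demanded at each level because directional derivability does not imply
    it. *)
Fixpoint Ck (k : nat) U f : Prop :=
  (forall p, U p -> {for p, continuous f}) /\
  match k with
  | 0 => True
  | k'.+1 => forall v, (forall p, U p -> derivable f p v) /\ Ck k' U ('D_v f)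
  end.

Lemma Ck_continuous k U f : Ck k U f -> forall p, U p -> {for p, continuous f}.
Proof. by case: k => [|k] []. Qed.

Lemma CkS k U f : Ck k.+1 U f -> Ck k U f.
Proof.
elim: k f => [f [cf _]|k IH f [cf df]]; first by split.
by split=> // v; have [dv ck] := df v; split=> //; exact: IH.
Qed.

Lemma near_eq_in U f g p : open U -> U p -> (forall q, U q -> f q = g q) ->
  \forall q \near p, f q = g q.
Proof. by move=> oU Up fg; near=> q; apply: fg; near: q; exact: open_nbhs_nbhs.
Unshelve. all: by end_near. Qed.

Lemma eq_Ck k U f g : open U -> (forall p, U p -> f p = g p) ->
  Ck k U f -> Ck k U g.
Proof.
move=> oU; elim: k f g => [|k IH] f g fg /= [cf df]; (split;
  first by move=> p Up; have fgp := near_eq_in oU Up fg;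
    rewrite /prop_for /continuous_at -fg//;
    apply: cvg_trans (cf p Up); exact: near_eq_cvg) => //.
move=> v; have [dv ck] := df v; split.
  by move=> p Up; apply: near_eq_derivable (dv _ Up); exact: near_eq_in oU Up fg.
apply: IH ck => p Up; apply: near_eq_derive; exact: near_eq_in oU Up fg.
Qed.

Lemma Ck_sub k U U' f : U' `<=` U -> Ck k U f -> Ck k U' f.
Proof.
move=> sU; elim: k f => [|k IH] f [cf df]; split=> //; try by move=> p /sU; exact: cf.
move=> v; have [dv ck] := df v; split; last exact: IH.
by move=> p /sU; exact: dv.
Qed.

Lemma Ck_setU k U U' f : Ck k U f -> Ck k U' f -> Ck k (U `|` U') f.
Proof.
elim: k f => [|k IH] f [cf df] [cf' df']; split=> //; try by move=> p []; auto.
move=> v; have [dv ck] := df v; have [dv' ck'] := df' v.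
by split; [move=> p []; auto|exact: IH].
Qed.

Lemma Ck_cst k U (c : R) : open U -> Ck k U (cst c).
Proof.
move=> oU; elim: k c => [|k IH] c; split => //; try by move=> p _; exact: cvg_cst.
move=> v; split; first by move=> p _; exact: derivable_cst.
by apply: eq_Ck (IH 0) => // p _; rewrite derive_cst.
Qed.

Lemma Ck_add k U f g : open U -> Ck k U f -> Ck k U g -> Ck k U (f \+ g).
Proof.
move=> oU; elim: k f g => [|k IH] f g [cf df] [cg dg].
  by split=> // p Up; apply: continuousD; [exact: cf|exact: cg].
split; first by move=> p Up; apply: continuousD; [exact: cf|exact: cg].
move=> v; have [dv ck] := df v; have [dv' ck'] := dg v; split.
  by move=> p Up; apply: derivableD; [exact: dv|exact: dv'].
apply: eq_Ck (IH _ _ ck ck') => // p Up.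
by rewrite deriveD//; [exact: dv|exact: dv'].
Qed.

Lemma Ck_mul k U f g : open U -> Ck k U f -> Ck k U g ->
  Ck k U (fun p => f p * g p).
Proof.
move=> oU; elim: k f g => [|k IH] f g Cf Cg.
  by split=> // p Up; apply: continuousM; [exact: (proj1 Cf)|exact: (proj1 Cg)].
have [cf df] := Cf; have [cg dg] := Cg.
split; first by move=> p Up; apply: continuousM; [exact: cf|exact: cg].
move=> v; have [dv ck] := df v; have [dv' ck'] := dg v; split.
  by move=> p Up; apply: derivableM; [exact: dv|exact: dv'].
have := Ck_add oU (IH _ _ (CkS Cf) ck') (IH _ _ (CkS Cg) ck).
apply: eq_Ck => // p Up.
by rewrite (deriveM (dv p Up) (dv' p Up)).
Qed.

Lemma Ck_scale k U (c : R) f : open U -> Ck k U f -> Ck k U (fun p => c * f p).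
Proof. by move=> oU; apply: Ck_mul => //; exact: Ck_cst. Qed.

Lemma Ck_sum k U (I : Type) (r : seq I) (f : I -> V -> R) : open U ->
  (forall i, Ck k U (f i)) -> Ck k U (fun p => \sum_(i <- r) f i p).
Proof.
move=> oU Cf; elim: r => [|i r IH].
  by apply: (eq_Ck (f:=cst 0)) (Ck_cst _ _ oU) => // p _; rewrite big_nil.
apply: (eq_Ck (f:=f i \+ (fun p => \sum_(i <- r) f i p))) => //.
  by move=> p _; rewrite big_cons.
exact: Ck_add.
Qed.

Lemma derive_line f p v : 'D_1 (fun s : R => f (s *: v + p)) 0 = 'D_v f p.
Proof.
rewrite /derive; set g1 := fun h => h^-1 *: _; set g2 := fun h => h^-1 *: _.
suff -> : g1 = g2 by [].
by rewrite funeqE /g1 /g2 => h /=; rewrite addr0 scale0r add0r [_%:A]mulr1.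
Qed.

(** Restricting to the line through [p] in direction [v] leaves the one-variable chain rule; no
    total differentiability of [f] is involved. *)
Lemma is_derive_comp1 (h : R -> R) f p v (dh : R) :
  is_derive (f p) 1 h dh -> derivable f p v ->
  is_derive p v (h \o f) (dh * 'D_v f p).
Proof.
move=> dhP dfP.
pose g (s : R) := f (s *: v + p).
have dg : derivable g 0 1 by exact: (derivable1P f p v).1.
have g0 : g 0 = f p by rewrite /g scale0r add0r.
have Dg : 'D_1 g 0 = 'D_v f p by exact: derive_line.
have gD : is_derive (0 : R) 1 g ('D_v f p) by rewrite -Dg; exact: derivableP.
rewrite -g0 in dhP.
have [hd hv] := is_derive1_comp dhP gD.
split; first exact: (derivable1P (h \o f) p v).2.
by rewrite -hv -(derive_line (h \o f)).
Qed.

(** [H] lists the successive derivatives of the outer function; keeping [i] general lets the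
    induction pass from [H i] to [H i.+1]. *)
Lemma Ck_comp k U f (A : set R) (H : nat -> R -> R) i : open U ->
  (forall p, U p -> A (f p)) ->
  (forall i z, A z -> is_derive z 1 (H i) (H i.+1 z)) ->
  Ck k U f -> Ck k U (H i \o f).
Proof.
move=> oU fA dH; elim: k i => [|k IH] i Cf; (split;
  first by move=> p Up; apply: continuous_comp; [exact: Ck_continuous Cf _ Up|];
    apply/differentiable_continuous/derivable1_diffP;
    case: (dH i _ (fA _ Up))) => //.
move=> v; have [_ /(_ v) [dv ck]] := Cf.
have D p : U p -> is_derive p v (H i \o f) (H i.+1 (f p) * 'D_v f p).
  by move=> Up; apply: is_derive_comp1; [exact/dH/fA|exact: dv].
split; first by move=> p /D[].
apply: eq_Ck (Ck_mul oU (IH i.+1 (CkS Cf)) ck) => // p Up.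
by have [_ ->] := D _ Up.
Qed.

Lemma Ck_exp k U f : open U -> Ck k U f -> Ck k U (fun p => expR (f p)).
Proof.
move=> oU; apply: (@Ck_comp k U f setT (fun=> expR) 0 oU) => //.
Qed.

(** The derivative -(1/f)^2 Df involves only 1/f at the previous order, which closes the
    induction. *)
Lemma Ck_inv k U f : open U -> (forall p, U p -> f p != 0) ->
  Ck k U f -> Ck k U (fun p => (f p)^-1).
Proof.
move=> oU f0; elim: k => [|k IH] Cf; (split;
  first by move=> p Up; apply: continuousV; [exact: f0|exact: Ck_continuous Cf _ Up]) => //.
move=> v; have [_ /(_ v) [dv ck]] := Cf.
split; first by move=> p Up; apply: derivableV; [exact: f0|exact: dv].
have Ci := IH (CkS Cf).
apply: eq_Ck (Ck_scale (-1) oU (Ck_mul oU (Ck_mul oU Ci Ci) ck)) => // p Up.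
rewrite (deriveV (f0 _ Up) (dv _ Up)).
by rewrite mulN1r expr2 invfM /GRing.scale /= mulNr.
Qed.

Lemma Ck_ln k U f : open U -> (forall p, U p -> 0 < f p) ->
  Ck k U f -> Ck k U (fun p => ln (f p)).
Proof.
move=> oU f0 Cf.
have fN0 p : U p -> f p != 0 by move=> /f0 /lt0r_neq0.
case: k Cf => [|k] Cf; (split;
  first by move=> p Up; apply: continuous_comp; [exact: Ck_continuous Cf _ Up|];
  exact: continuous_ln (f0 _ Up)) => //.
move=> v; have [_ /(_ v) [dv ck]] := Cf.
have D p : U p -> is_derive p v (@ln R \o f) ((f p)^-1 * 'D_v f p).
  by move=> Up; apply: is_derive_comp1; [exact/is_derive1_ln/f0|exact: dv].
split; first by move=> p /D[].
apply: eq_Ck (Ck_mul oU (Ck_inv oU fN0 (CkS Cf)) ck) => // p Up.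
by have [_ ->] := D _ Up.
Qed.

Lemma Ck_affine k U f : open U -> continuous f ->
  (forall v, exists c, forall q, is_derive q v f c) -> Ck k U f.
Proof.
move=> oU cf df; case: k => [|k]; split => //; try by move=> p _; exact: cf.
move=> v; have [c dc] := df v; split; first by move=> p _; have [] := dc p.
by apply: eq_Ck (Ck_cst _ c oU) => // p _; have [_ ->] := dc p.
Qed.

(** [iter_der] applies the last direction first, whereas [Ck] unfolds from the innermost derivative;
    this reconciles the two recursions. *)
Lemma iter_der_rcons (vs : seq V) v f :
  iter_der (rcons vs v) f = iter_der vs ('D_v f).
Proof. by elim: vs => //= w vs ->. Qed.

Lemma Ck_iter_der k U (vs : seq V) f : Ck (size vs + k) U f -> Ck k U (iter_der vs f).
Proof.
elim/last_ind: vs f => [f //|vs v IH f]; rewrite size_rcons addSn => -[_ /(_ v)[_ ck]].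
by rewrite iter_der_rcons; exact: IH.
Qed.

Lemma smooth_onP U f : open U -> (forall k, Ck k U f) -> smooth_on U f.
Proof.
move=> oU Cf vs; have C1 := @Ck_iter_der 1 U vs f (Cf _); have [cf df] := C1.
split; first by apply/continuous_in_subspaceT => p /set_mem; exact: cf.
by move=> v p Up; have [dv _] := df v; exact: dv.
Qed.

Lemma eq_iter_der U f g (vs : seq V) : open U -> (forall p, U p -> f p = g p) ->
  forall p, U p -> iter_der vs f p = iter_der vs g p.
Proof.
move=> oU fg; elim: vs => [//|v vs IH] p Up /=.
by apply: near_eq_derive; exact: near_eq_in oU Up IH.
Qed.

Lemma iter_der_sum U (I : Type) (r : seq I) (c : I -> R) (f : I -> V -> R) (vs : seq V) :
  open U -> (forall i k, Ck k U (f i)) ->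
  forall p, U p -> iter_der vs (fun p => \sum_(i <- r) c i * f i p) p
     = \sum_(i <- r) c i * iter_der vs (f i) p.
Proof.
move=> oU Cf; elim: vs => [//|v vs IH] p Up /=.
rewrite (near_eq_derive (g := fun p => \sum_(i <- r) c i * iter_der vs (f i) p));
  last exact: near_eq_in oU Up IH.
have dv i q : U q -> is_derive q v (iter_der vs (f i)) ('D_v (iter_der vs (f i)) q).
  move=> Uq; apply: derivableP.
  have [_ /(_ v) [dv _]] := @Ck_iter_der 1 U vs (f i) (Cf _ _); exact: dv.
suff : is_derive p v (fun p => \sum_(i <- r) c i * iter_der vs (f i) p) (\sum_(i <- r) c i * 'D_v (iter_der vs (f i)) p) by case.
elim: r {IH} => [|i r IHr].
  rewrite big_nil (_ : (fun _ => _) = cst 0); first exact: is_derive_cst.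
  by apply/funext => q; rewrite big_nil.
rewrite big_cons (_ : (fun _ => _) = (c i \*: iter_der vs (f i)) + (fun p => \sum_(i <- r) c i * iter_der vs (f i) p)); last first.
  by apply/funext => q; rewrite big_cons.
have := dv i p Up => Di.
exact: is_deriveD.
Qed.

Lemma iter_der_shift f (a : V) (vs : seq V) p :
  iter_der vs (fun q => f (q + a)) p = iter_der vs f (p + a).
Proof.
elim: vs p => [//|v vs IH] p /=.
rewrite (_ : iter_der vs (fun q => f (q + a)) = fun q => iter_der vs f (q + a)); last exact/funext.
rewrite /derive; set g1 := fun h => h^-1 *: _; set g2 := fun h => h^-1 *: _.
suff -> : g1 = g2 by [].
by rewrite funeqE /g1 /g2 => h /=; rewrite addrA.
Qed.

End ck.

(** * Differentiation of series *)

Section taylor.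
Context {R : realType}.

Lemma MVT_origin (g g' : R -> R) (d h : R) : `|h| < d ->
  (forall s : R, `|s| < d -> is_derive s 1 g (g' s)) ->
  exists2 c, `|c| <= `|h| & g h - g 0 = g' c * h.
Proof.
move=> hd dg.
have cg a b : - d < a -> b < d -> {within `[a, b], continuous g}.
  move=> da bd; apply/continuous_in_subspaceT => s /set_mem /=.
  rewrite in_itv /= => /andP[as_ sb].
  apply/differentiable_continuous/derivable1_diffP.
  by have [] := dg s; rewrite // ltr_norml (lt_le_trans da)//= (le_lt_trans sb).
have dg' a b : - d < a -> b < d ->
    forall s : R, s \in `]a, b[%R -> is_derive s 1 g (g' s).
  move=> da bd s; rewrite in_itv /= => /andP[as_ sb]; apply: dg.
  by rewrite ltr_norml (lt_trans da)//= (lt_trans sb).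
have d0 : 0 < d := le_lt_trans (normr_ge0 h) hd.
move: (hd); rewrite ltr_norml => /andP[h1 h2].
have [h0|h0] := leP 0 h.
  have [c] := MVT_segment h0 (dg' 0 h ltac:(by rewrite oppr_lt0) h2) (cg 0 h ltac:(by rewrite oppr_lt0) h2).
  rewrite in_itv /= => /andP[c0 ch]; rewrite subr0 => E; exists c => //.
  by rewrite !ger0_norm.
have [c] := MVT_segment (ltW h0) (dg' h 0 h1 d0) (cg h 0 h1 d0).
rewrite in_itv /= => /andP[c0 ch]; rewrite sub0r => E; exists c => //.
  by rewrite !ler0_norm// ?lerN2// ltW.
by rewrite -opprB E mulrN opprK.
Qed.

(** The mean value theorem, applied to [g] and then to [g']; this loses the usual factor 1/2, which
    is harmless. *)
Lemma taylor1_bound (g g' g'' : R -> R) (d h M : R) : `|h| < d ->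
  (forall s : R, `|s| < d -> is_derive s 1 g (g' s)) ->
  (forall s : R, `|s| < d -> is_derive s 1 g' (g'' s)) ->
  (forall s : R, `|s| < d -> `|g'' s| <= M) ->
  `|g h - g 0 - h * g' 0| <= M * `|h| ^+ 2.
Proof.
move=> hd dg dg' M2.
have [c ch ->] := MVT_origin hd dg.
have cd := le_lt_trans ch hd.
have [c' c'c E] := MVT_origin cd dg'.
have c'd := le_lt_trans c'c cd.
rewrite [h * _]mulrC -mulrBl E !normrM expr2 mulrA ler_wpM2r//.
by apply: ler_pM => //; exact: M2.
Qed.

End taylor.

Section smooth_series.
Context {R : realType} {V : normedModType R}.

Lemma is_derive_line (f : V -> R) (p v : V) (s : R) : derivable f (s *: v + p) v ->
  is_derive s 1 (fun s : R => f (s *: v + p)) ('D_v f (s *: v + p)).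
Proof.
rewrite {1}/derivable; set g1 := fun h => h^-1 *: _.
pose g2 (h : R) := h^-1 *: (((fun s : R => f (s *: v + p)) \o shift s) (h *: 1) - f (s *: v + p)).
have E : g1 = g2.
  rewrite funeqE /g1 /g2 => h /=; congr (_ *: (f _ - _)).
  by rewrite [h%:A]mulr1 scalerDl addrA.
move=> dv; split; first by rewrite /derivable -/g2 -E.
by rewrite /derive -/g2 -/g1 -E.
Qed.

Variables (U : set V) (oU : open U) (W : nat -> V -> R) (b : nat -> R).
Hypothesis b0 : forall j, 0 <= b j.
Hypothesis cb : cvgn (series b).

Lemma dominated_series (x : nat -> R) (C : R) : (forall j, `|x j| <= C * b j) ->
  cvgn (series x) /\ `|limn (series x)| <= C * limn (series b).
Proof.
move=> xb.
have cCb : cvgn (series (C *: b)) by exact: is_cvg_seriesZ.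
have cn : cvgn [normed series x].
  apply: series_le_cvg cCb => n; [exact: normr_ge0| |exact: xb].
  exact: le_trans (normr_ge0 _) (xb n).
split; first exact: normed_cvg.
apply: le_trans (lim_series_norm cn) _.
rewrite -[leRHS]/(C *: limn (series b)) -lim_seriesZ//.
exact: lim_series_le.
Qed.

Hypothesis CW : forall j k, Ck k U (W j).
(** The constant may vary with the derivative and the point; only the summable weight [b] is common.
    Taking two further derivatives in [vs] gives the control needed to differentiate term by
    term. *)
Hypothesis dom : forall vs p, U p ->
  exists C, \forall q \near p, forall j, `|iter_der vs (W j) q| <= C * b j.

Let S vs q := limn (series (fun j => iter_der vs (W j) q)).

Lemma cvg_iter_der_series vs p : U p -> cvgn (series (fun j => iter_der vs (W j) p)).
Proof.
move=> Up; have [C /nbhs_singleton HC] := dom vs Up.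
by have [] := dominated_series HC.
Qed.

(* A bound on the second derivatives makes the difference quotients of all the
   terms converge at the rate h * b j. *)
Lemma is_derive_series vs v p : U p -> is_derive p v (S vs) (S (v :: vs) p).
Proof.
move=> Up; have [C HC] := dom [:: v, v & vs] Up.
have nb : nbhs p (fun q => U q /\ forall j, `|iter_der [:: v, v & vs] (W j) q| <= C * b j).
  by apply: filterI => //; exact: open_nbhs_nbhs.
have : \forall s \near (0 : R), U (s *: v + p) /\ forall j, `|iter_der [:: v, v & vs] (W j) (s *: v + p)| <= C * b j.
  have cl : {for (0 : R), continuous (fun s : R => s *: v + p)}.
    by apply: continuousD; [exact: scalel_continuous|exact: cvg_cst].
  by move: nb; rewrite -{1}[p](add0r p) -(scale0r v); exact: cl.
move=> /nbhs_ballP[d /= d0 Hd].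
have Hd' s : `|s| < d -> U (s *: v + p) /\ forall j, `|iter_der [:: v, v & vs] (W j) (s *: v + p)| <= C * b j.
  by move=> sd; apply: Hd; rewrite -ball_normE /= sub0r normrN.
have key h : `|h| < d -> `|S vs (h *: v + p) - S vs p - h * S (v :: vs) p| <= C * limn (series b) * `|h| ^+ 2.
  move=> hd; have [Uh _] := Hd' h hd.
  pose x j := iter_der vs (W j) (h *: v + p) - iter_der vs (W j) p - h * iter_der (v :: vs) (W j) p.
  have xb j : `|x j| <= (C * `|h| ^+ 2) * b j.
    rewrite mulrAC.
    have := @taylor1_bound R (fun s => iter_der vs (W j) (s *: v + p))
       (fun s => iter_der (v :: vs) (W j) (s *: v + p))
       (fun s => iter_der [:: v, v & vs] (W j) (s *: v + p)) d h (C * b j) hd.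
    rewrite !scale0r !add0r; apply.
    - move=> s /Hd'[Us _]; apply: is_derive_line.
      by have [_ /(_ v)[dv _]] := @Ck_iter_der _ _ 1 U vs (W j) (CW _ _); exact: dv.
    - move=> s /Hd'[Us _]; apply: (@is_derive_line (iter_der (v :: vs) (W j))).
      by have [_ /(_ v)[dv _]] := @Ck_iter_der _ _ 1 U (v :: vs) (W j) (CW _ _); exact: dv.
    - by move=> s /Hd'[_]; apply.
  have [_] := dominated_series xb.
  suff -> : limn (series x) = S vs (h *: v + p) - S vs p - h * S (v :: vs) p by rewrite mulrAC.
  have c1 := @cvg_iter_der_series vs _ Uh.
  have c2 := @cvg_iter_der_series vs _ Up.
  have c3 := @cvg_iter_der_series (v :: vs) _ Up.
  have -> : x = ((fun j => iter_der vs (W j) (h *: v + p)) - (fun j => iter_der vs (W j) p)) - h *: (fun j => iter_der (v :: vs) (W j) p) by [].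
  rewrite lim_seriesB; [|exact: is_cvg_seriesB|exact: is_cvg_seriesZ].
  by rewrite lim_seriesB// lim_seriesZ.
suff D : (fun h => h^-1 *: ((S vs \o shift p) (h *: v) - S vs p)) @ 0^' --> S (v :: vs) p.
  by split; [exact: cvgP D|exact: cvg_lim D].
suff D : (h^-1 *: ((S vs \o shift p) (h *: v) - S vs p) - S (v :: vs) p) @[h --> 0^'] --> (0 : R).
  by apply: (cvg_sub0 (g := cst (S (v :: vs) p))); [exact: D|exact: cvg_cst].
apply: (@cvg_to_0_linear _ _ (C * limn (series b)) d d0) => h /andP[h0 hd].
have hN0 : h != 0 by rewrite -normr_gt0.
have := key h hd; rewrite /= => K.
have -> : h^-1 *: (S vs (h *: v + p) - S vs p) - S (v :: vs) p =
   h^-1 * (S vs (h *: v + p) - S vs p - h * S (v :: vs) p).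
  by rewrite [RHS]mulrBr mulKf.
rewrite normrM normfV ler_pdivrMl// (le_trans K)//.
by rewrite expr2; lra.
Qed.

Lemma continuous_series vs p : U p -> {for p, continuous (S vs)}.
Proof.
move=> Up; have [C HC] := dom vs Up.
have C0 : 0 <= `|C| by [].
apply/cvgrPdist_le => e e0.
(* The factor 2 pays for the tail at [p] and the tail at the nearby point; the other e/2 is for the
   partial sum. *)
have tail : \forall N \near \oo, 2 * `|C| * (limn (series b) - series b N) <= e / 2.
  have : (2 * `|C| * (limn (series b) - series b N)) @[N --> \oo] --> (0 : R).
    rewrite -[X in _ --> X](mulr0 (2 * `|C|)); apply: cvgMr.
    rewrite -(subrr (limn (series b))); apply: cvgB; first exact: cvg_cst.
    exact: cb.
  move/cvgrPdist_le => /(_ (e / 2)); rewrite divr_gt0// => /(_ isT).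
  apply: filterS => N; rewrite sub0r normrN; apply: le_trans; exact: ler_norm.
have [N _ /(_ N (leqnn N)) HN] := tail.
have tl q : U q -> (forall j, `|iter_der vs (W j) q| <= C * b j) ->
   `|S vs q - series (fun j => iter_der vs (W j) q) N| <= `|C| * (limn (series b) - series b N).
  move=> Uq Hq; have cq := @cvg_iter_der_series vs _ Uq.
  have bnd n : (N <= n)%N -> `|series (fun j => iter_der vs (W j) q) n - series (fun j => iter_der vs (W j) q) N| <= `|C| * (limn (series b) - series b N).
    move=> Nn; rewrite sub_series_geq// (le_trans (ler_norm_sum _ _ _))//.
    apply: (@le_trans _ _ (`|C| * (series b n - series b N))).
      rewrite sub_series_geq// mulr_sumr; apply: ler_sum => j _.
      by rewrite (le_trans (Hq j))// ler_wpM2r// ler_norm.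
    rewrite ler_wpM2l// lerD2r; apply: nondecreasing_cvgn_le => //.
    exact: nondecreasing_series.
  have : (`|series (fun j => iter_der vs (W j) q) n - series (fun j => iter_der vs (W j) q) N|) @[n --> \oo] --> `|S vs q - series (fun j => iter_der vs (W j) q) N|.
    by apply: cvg_norm; apply: cvgB => //; exact: cvg_cst.
  move=> cv; rewrite -(cvg_lim _ cv)//; apply: limr_le; first exact: cvgP cv.
  by near=> n; apply: bnd; near: n; exact: nbhs_infty_ge.
have cN : {for p, continuous (fun q => series (fun j => iter_der vs (W j) q) N)}.
  have := @Ck_sum R V 0 U nat (index_iota 0 N) (fun j => iter_der vs (W j)) oU.
  move=> /(_ _)/Ck_continuous; apply => // j.
  by apply: Ck_iter_der; exact: CW.
have e2 : 0 < e / 2 by rewrite divr_gt0.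
move/cvgrPdist_le : cN => /(_ _ e2) cN.
near=> q.
have Uq : U q by near: q; exact: open_nbhs_nbhs.
have Hq : forall j, `|iter_der vs (W j) q| <= C * b j by near: q.
have h1 := tl _ Up (nbhs_singleton HC).
have h2 := tl _ Uq Hq.
have h3 : `|series (fun j => iter_der vs (W j) p) N - series (fun j => iter_der vs (W j) q) N| <= e / 2 by near: q.
move: h1 h2 h3 HN; set a1 := S vs p; set a2 := S vs q.
set s1 := series _ N; set s2 := series (fun j => iter_der vs (W j) q) N.
set r := `|C| * _ => h1 h2 h3 HN.
have -> : a1 - a2 = (a1 - s1) + (s1 - s2) - (a2 - s2) by ring.
rewrite (le_trans (ler_normB _ _))// (le_trans (lerD (ler_normD _ _) (lexx _)))//.
by move: HN; rewrite -mulrA -/r => HN; lra.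
Unshelve. all: by end_near. Qed.

(** Generality in [vs] makes the induction work: the derivative of [S vs] along [v] is again of this
    form, [S (v :: vs)]. *)
Lemma Ck_series k vs : Ck k U (S vs).
Proof.
elim: k vs => [|k IH] vs; split => //; try by move=> p Up; exact: continuous_series.
move=> v; split; first by move=> p Up; have [] := @is_derive_series vs v _ Up.
apply: eq_Ck (IH (v :: vs)) => // p Up.
by have [_ ->] := @is_derive_series vs v _ Up.
Qed.

Lemma iter_der_series vs p : U p ->
  iter_der vs (fun q => limn (series (fun j => W j q))) p =
  limn (series (fun j => iter_der vs (W j) p)).
Proof.
elim: vs p => [//|v vs IH] p Up /=.
rewrite (near_eq_derive (g := S vs)); last exact: near_eq_in oU Up IH.
by have [_ ->] := @is_derive_series vs v _ Up.
Qed.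

End smooth_series.

(** * Iterated integrals *)

Section integrals.
Context {R : realType}.
Local Notation mu := (@lebesgue_measure R).
Local Open Scope ereal_scope.

(* For nonnegative functions, measurable or not, the integral is the supremum of
   the integrals of the simple functions below. *)
Lemma le_integral_restrict (D D' : set R) (f g : R -> \bar R) :
  (forall x, 0 <= (f \_ D) x <= (g \_ D') x) ->
  \int[mu]_(x in D) f x <= \int[mu]_(x in D') g x.
Proof.
move=> fg; rewrite [leLHS]integral_mkcond [leRHS]integral_mkcond.
rewrite !ge0_integralTE; [|by move=> x; have /andP[f0 fg'] := fg x; exact: le_trans fg'|by move=> x; have /andP[] := fg x].
apply: ereal_sup_le => _ [h /= hf <-]; exists h => // x.
by have /andP[_] := fg x; exact: le_trans.
Qed.

Lemma le_integral_ge0 (D : set R) (f g : R -> \bar R) :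
  (forall x, D x -> 0 <= f x) -> (forall x, D x -> f x <= g x) ->
  \int[mu]_(x in D) f x <= \int[mu]_(x in D) g x.
Proof.
move=> f0 fg; apply: le_integral_restrict => x; rewrite /patch.
by case: ifPn => [/set_mem Dx|_]; [rewrite f0// fg|rewrite lexx].
Qed.

Lemma integral_Rn_ge0 n (f : 'rV[R]_n -> \bar R) :
  (forall v, 0 <= f v) -> 0 <= integral_Rn f.
Proof.
by elim: n f => [|n IH] f f0 /=; [exact: f0|apply: integral_ge0 => c _; exact: IH].
Qed.

Lemma le_integral_Rn n (f g : 'rV[R]_n -> \bar R) :
  (forall v, 0 <= f v) -> (forall v, f v <= g v) -> integral_Rn f <= integral_Rn g.
Proof.
elim: n f g => [|n IH] f g f0 fg /=; first exact: fg.
apply: le_integral_ge0 => c _; first by apply: integral_Rn_ge0.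
exact: IH.
Qed.

Lemma eq_integral_Rn n (f g : 'rV[R]_n -> \bar R) :
  (forall v, f v = g v) -> integral_Rn f = integral_Rn g.
Proof. by move=> fg; congr integral_Rn; apply/funext. Qed.

Lemma row_mx_consE n (c : R) (v : 'rV[R]_n) :
  (row_mx (const_mx c : 'rV[R]_1) v : 'rV[R]_n.+1) 0%R ord0 = c /\
  forall i, (row_mx (const_mx c : 'rV[R]_1) v : 'rV[R]_n.+1) 0%R (lift ord0 i) = v 0%R i.
Proof.
split=> [|i].
  transitivity (row_mx (const_mx c : 'rV[R]_1) v 0%R (lshift n ord0)).
    by congr (fun_of_matrix _ _ _); exact: val_inj.
  by rewrite row_mxEl mxE.
transitivity (row_mx (const_mx c : 'rV[R]_1) v 0%R (rshift 1 i)).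
  by congr (fun_of_matrix _ _ _); exact: val_inj.
by rewrite row_mxEr.
Qed.

Lemma sqnorm_cons n (c : R) (v : 'rV[R]_n) :
  sqnorm (row_mx (const_mx c : 'rV[R]_1) v : 'rV[R]_n.+1) = (c ^+ 2 + sqnorm v)%R.
Proof.
have [E0 ES] := row_mx_consE c v.
by rewrite /sqnorm big_ord_recl E0; congr (_ + _)%R; apply: eq_bigr => i _; rewrite ES.
Qed.

(** Test function for lower bounds. The factor [c] absorbs the indicator of the first coordinate
    when the iterated integral is unfolded. *)
Lemma integral_Rn_box n (a : 'I_n -> R) (r c : R) : (0 < r)%R -> (0 <= c)%R ->
  integral_Rn (fun y : 'rV[R]_n =>
    (c * \prod_(i < n) \1_(`[a i, (a i + r)%R]%classic : set R) (y 0%R i))%:E)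
  = (c * r ^+ n)%:E.
Proof.
move=> r0; elim: n a c => [|n IH] a c c0 /=; first by rewrite big_ord0 expr0.
under eq_integral => z _.
  rewrite (_ : integral_Rn _ = (c * r ^+ n)%:E * (\1_(`[a ord0, (a ord0 + r)%R]%classic : set R) z)%:E); last first.
    rewrite -EFinM mulrAC -(IH (fun i => a (lift ord0 i))); last by rewrite mulr_ge0// indicE.
    apply: eq_integral_Rn => v; congr EFin; rewrite big_ord_recl.
    have [-> ES] := row_mx_consE z v.
    by rewrite mulrA; congr (_ * _)%R; apply: eq_bigr => i _; rewrite ES.
  over.
have k0 : (0 <= c * r ^+ n)%R by rewrite mulr_ge0// exprn_ge0// ltW.
have i0 x : [set: R] x -> 0 <= (\1_(`[a ord0, (a ord0 + r)%R]%classic : set R) x)%:E.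
  by rewrite lee_fin indicE.
rewrite ge0_integralZl_EFin//; last by apply/measurable_EFinP; exact: measurable_indic.
rewrite integral_indic//= setIT lebesgue_measure_itv/= lte_fin ltrDl r0.
by rewrite -EFinB addrAC subrr add0r -EFinM exprSr mulrA.
Qed.

(** Rescaled total mass of the normal density with variance 1/(2b). *)
Lemma integral_gauss (b : R) : (0 < b)%R ->
  \int[mu]_x (expR (- (b * x ^+ 2)))%:E = (Num.sqrt (pi / b))%:E.
Proof.
move=> b0; pose s := ((Num.sqrt (2 * b))^-1)%R.
have s0 : s != 0%R by rewrite invr_eq0 sqrtr_eq0 -ltNge mulr_gt0.
have s2 : (s ^+ 2 = (2 * b)^-1)%R by rewrite exprVn sqr_sqrtr// mulr_ge0// ltW.
have := @integral_normal_pdf R 0%R s; rewrite normal_pdfE//.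
have pk : (0 < normal_peak s)%R by exact: normal_peak_gt0.
under eq_integral do rewrite EFinM.
have i0 x : [set: R] x -> 0 <= (normal_fun 0 s x)%:E by rewrite lee_fin expR_ge0.
rewrite ge0_integralZl_EFin//; [|by apply/measurable_EFinP; exact: measurable_normal_fun|exact: ltW].
have -> : (fun x => (normal_fun 0 s x)%:E) = (fun x => (expR (- (b * x ^+ 2)))%:E).
  apply/funext => x; rewrite /normal_fun subr0 s2; congr (expR _)%:E.
  by field; rewrite lt0r_neq0.
move=> H; have : (normal_peak s)^-1%:E * ((normal_peak s)%:E * \int[mu]_x (expR (- (b * x ^+ 2)))%:E) = (normal_peak s)^-1%:E * 1 by rewrite H.
rewrite muleA -EFinM mulVf ?lt0r_neq0// mul1e mule1 => ->.
rewrite /normal_peak invrK s2; congr (Num.sqrt _)%:E.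
by rewrite -mulr_natr; field; rewrite lt0r_neq0.
Qed.

Lemma measurable_gauss (b : R) : measurable_fun [set: R] (fun x : R => expR (- (b * x ^+ 2))%R).
Proof.
apply: measurableT_comp => //; apply: measurableT_comp => //.
by apply: measurable_funM => //; apply: measurable_funX.
Qed.

(** Monotone convergence is used one coordinate at a time, so that only one-dimensional Gaussians
    need be measurable. Free coefficients [c] absorb the exponential of the coordinate set aside. *)
Lemma integral_Rn_gauss_series n (K : nat -> nat) (c b : nat -> nat -> R) :
  (forall j k, (0 <= c j k)%R) -> (forall j k, (0 < b j k)%R) ->
  integral_Rn (fun v : 'rV[R]_n =>
    \sum_(j <oo) \sum_(k < K j) (c j k * expR (- (b j k * sqnorm v)))%:E)
  = \sum_(j <oo) \sum_(k < K j) (c j k * Num.sqrt (pi / b j k) ^+ n)%:E.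
Proof.
move=> c0 b0; elim: n c c0 => [|n IH] c c0 /=.
  apply: eq_eseriesr => j _; apply: eq_bigr => k _.
  by rewrite /sqnorm big_ord0 mulr0 oppr0 expR0 expr0.
under eq_integral => z _.
  rewrite (_ : integral_Rn _ = \sum_(j <oo) \sum_(k < K j)
     ((c j k * Num.sqrt (pi / b j k) ^+ n)%:E * (expR (- (b j k * z ^+ 2)))%:E)); last first.
    transitivity (\sum_(j <oo) \sum_(k < K j)
       ((c j k * expR (- (b j k * z ^+ 2))) * Num.sqrt (pi / b j k) ^+ n)%:E).
      rewrite -(IH (fun j k => c j k * expR (- (b j k * z ^+ 2)))%R); last first.
        by move=> j k; rewrite mulr_ge0// expR_ge0.
      apply: eq_integral_Rn => v; apply: eq_eseriesr => j _; apply: eq_bigr => k _.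
      by rewrite sqnorm_cons mulrDr opprD expRD mulrA.
    by apply: eq_eseriesr => j _; apply: eq_bigr => k _; rewrite -EFinM mulrAC.
  over.
have t0 j k z : 0 <= (c j k * Num.sqrt (pi / b j k) ^+ n)%:E * (expR (- (b j k * z ^+ 2)))%:E.
  by rewrite -EFinM lee_fin !mulr_ge0// ?expR_ge0// exprn_ge0// sqrtr_ge0.
rewrite integral_nneseries//; last 2 first.
- by move=> j; apply: emeasurable_sum => k; apply/measurable_EFinP;
    apply: measurable_funM => //; exact: measurable_gauss.
- by move=> j z _; apply: sume_ge0.
apply: eq_eseriesr => j _.
rewrite ge0_integral_sum//; last by move=> k; apply/measurable_EFinP;
    apply: measurable_funM => //; exact: measurable_gauss.
apply: eq_bigr => k _.
have k0 : (0 <= c j k * Num.sqrt (pi / b j k) ^+ n)%R.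
  by rewrite mulr_ge0// exprn_ge0// sqrtr_ge0.
have i0 x : [set: R] x -> 0 <= (expR (- (b j k * x ^+ 2)))%:E.
  by rewrite lee_fin expR_ge0.
rewrite ge0_integralZl_EFin//; last by apply/measurable_EFinP; exact: measurable_gauss.
by rewrite integral_gauss// -EFinM exprSr mulrA.
Qed.

(** The gain is uniformity: the bound depends on [a] and [r] only through [M], hence serves all
    terms of the tower at once. *)
Lemma integral_shifted_powR (a r be M : R) : (0 < r)%R -> (-1 < be)%R -> (1 - a + r <= M)%R ->
  \int[mu]_(s in `]0%R, 1%R[) (\1_(`]a, +oo[%classic : set R) s * (s - a + r) `^ be)%:E
  <= (M `^ (be + 1) / (be + 1))%:E.
Proof.
move=> r0 be1 aM.
have be0 : (0 < be + 1)%R by rewrite -ltrBlDr sub0r.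
pose lo : R := Num.max a 0%R.
have [lo1|lo1] := ltP lo 1%R; last first.
  apply: (@le_trans _ _ 0); last by rewrite lee_fin divr_ge0 ?powR_ge0// ltW.
  rewrite integral0_eq// => s /=; rewrite in_itv /= => /andP[s0 s1].
  rewrite indicE; case: (boolP (s \in _)) => [|_]; last by rewrite mul0r.
  rewrite inE /= in_itv /= andbT => sa.
  move: lo1; rewrite le_max => /orP[a1|]; last by rewrite ler10.
  by move: (lt_trans s1 (le_lt_trans a1 sa)); rewrite ltxx.
apply: (@le_trans _ _ (\int[mu]_(s in `[lo, 1%R]) ((s - a + r) `^ be)%:E)).
  apply: le_integral_restrict => s; rewrite /patch.
  case: ifPn => [|_]; last by case: ifPn; rewrite lexx//= lee_fin powR_ge0.
  rewrite inE /= in_itv /= => /andP[s0 s1].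
  rewrite lee_fin mulr_ge0 ?powR_ge0// ?indicE//=.
  case: (boolP (s \in (`]a, +oo[%classic : set R))) => [|_]; last by rewrite mul0r; case: ifPn; rewrite ?lexx// lee_fin powR_ge0.
  rewrite inE /= in_itv /= andbT mul1r => sa.
  by rewrite ifT// inE /= in_itv /= ge_max (ltW sa) (ltW s0) ltW.
have pos s : (lo <= s)%R -> (0 < s - a + r)%R.
  by rewrite /lo ge_max => /andP[as_ _]; lra.
have D s : (lo <= s)%R -> is_derive s (1%R : R) (fun s => ((s - a + r) `^ (be + 1) / (be + 1))%R) ((s - a + r) `^ be)%R.
  move=> ls; have p := pos s ls.
  have D1 : is_derive s (1%R : R) (fun s : R => s - a + r)%R 1%R.
    by apply: is_derive_eq; rewrite oppr0 !addr0.
  have D2 := is_derive1_powR (be + 1) p.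
  have D3 := @is_derive1_comp R _ (fun s : R => s - a + r)%R s _ _ D2 D1.
  have -> : (fun s : R => ((s - a + r) `^ (be + 1) / (be + 1))%R) = ((be + 1)^-1 *: ((fun x => x `^ (be + 1)) \o (fun s : R => s - a + r)))%R.
    by apply/funext => x /=; rewrite mulrC.
  apply: is_derive_eq; rewrite addrK mulr1 /GRing.scale/= mulrA mulVf ?mul1r//.
  by rewrite lt0r_neq0.
have Dc s : (lo <= s)%R -> {for s, continuous (fun s => ((s - a + r) `^ (be + 1) / (be + 1))%R)}.
  by move=> ls; apply/differentiable_continuous/derivable1_diffP; have [] := D s ls.
rewrite (@continuous_FTC2 R _ (fun s => ((s - a + r) `^ (be + 1) / (be + 1))%R))//.
- rewrite -EFinB lee_fin; apply: (@le_trans _ _ ((1 - a + r) `^ (be + 1) / (be + 1))%R).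
    by rewrite gerBl divr_ge0 ?powR_ge0// ltW.
  rewrite ler_pM2r ?invr_gt0// ge0_ler_powR// ?nnegrE; first exact: ltW.
    by apply/ltW/pos/ltW.
  by apply: le_trans aM; apply/ltW/pos/ltW.
- apply/continuous_in_subspaceT => s /set_mem /=; rewrite in_itv /= => /andP[ls _].
  have p := pos s ls.
  apply: (@continuous_comp _ _ _ (fun s : R => s - a + r)%R (fun x => x `^ be)%R).
    by apply: continuousD; [apply: continuousB => //; exact: cvg_cst|exact: cvg_cst].
  apply/differentiable_continuous/derivable1_diffP.
  by have [] := is_derive1_powR be p.
- split.
  + by move=> s; rewrite in_itv /= => /andP[ls _]; have [] := D s (ltW ls).
  + by apply: cvg_at_right_filter; exact: Dc.
  + by apply: cvg_at_left_filter; exact: Dc (ltW _).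
- by move=> s; rewrite in_itv /= => /andP[ls _]; rewrite derive1E; have [_ ->] := D s (ltW ls).
Qed.

End integrals.

(** * A smooth step function *)

Section cutoff.
Context {R : realType}.

(** The m-th power of y/m <= exp(y/m). *)
Lemma exprn_le_expR (m : nat) (y : R) : 0 <= y -> y ^+ m <= m%:R ^+ m * expR y.
Proof.
move=> y0; case: m => [|m]; first by rewrite !expr0 mul1r -[leLHS]expR0 ler_expR.
have m0 : 0 < m.+1%:R :> R by rewrite ltr0n.
have -> : expR y = expR (y / m.+1%:R) ^+ m.+1.
  by rewrite -expRM_natl mulrC divfK// lt0r_neq0.
rewrite -exprMn; apply: lerXn2r; rewrite ?nnegrE ?mulr_ge0 ?expR_ge0 ?ler0n//.
rewrite -ler_pdivrMl// mulrC; apply: le_trans (expR_ge1Dx _).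
by rewrite lerDr.
Qed.

(** With y = 1/z the bound is C z^2, so the difference quotient of [flat] at 0 is O(z) and tends to
    0. *)
Lemma horner_exp_bound (P : {poly R}) :
  exists2 C, 0 <= C & forall y, 1 <= y -> `|P.[y] * expR (- y)| <= C * y ^- 2.
Proof.
pose m := (size P + 2)%N.
exists ((\sum_(i < size P) `|P`_i|) * m%:R ^+ m).
  by rewrite mulr_ge0// ?sumr_ge0// exprn_ge0.
move=> y y1; have y0 : 0 < y := lt_le_trans ltr01 y1.
have H1 : `|P.[y]| <= (\sum_(i < size P) `|P`_i|) * y ^+ size P.
  rewrite horner_coef mulr_suml (le_trans (ler_norm_sum _ _ _))//.
  apply: ler_sum => i _; rewrite normrM (ger0_norm (exprn_ge0 _ (ltW y0))) ler_wpM2l//.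
  by rewrite ler_weXn2l// ltnW.
rewrite normrM (ger0_norm (expR_ge0 _)) ler_pdivlMr ?exprn_gt0//.
rewrite expRN -mulrA.
apply: (@le_trans _ _ ((\sum_(i < size P) `|P`_i|) * y ^+ size P * ((expR y)^-1 * y ^+ 2))).
  by rewrite ler_wpM2r// mulr_ge0 ?invr_ge0 ?expR_ge0 ?exprn_ge0// ltW.
rewrite -!mulrA ler_wpM2l ?sumr_ge0// mulrCA -exprD mulrC ler_pdivrMr ?expR_gt0//.
by apply: exprn_le_expR; exact: ltW.
Qed.

(** For z > 0, differentiating P(1/z) exp(-1/z) gives Q(1/z) exp(-1/z) with Q = X^2 (P - P'). *)
Definition flat_poly (k : nat) : {poly R} := iter k (fun P => 'X^2 * (P - P^`())) 1.

(* The k-th derivative of exp(-1/z), extended by 0 to z <= 0. *)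
Definition flat (k : nat) (z : R) : R :=
  if 0 < z then (flat_poly k).[z^-1] * expR (- z^-1) else 0.

Lemma flat_le0 k z : z <= 0 -> flat k z = 0.
Proof. by rewrite /flat ltNge => ->. Qed.

Lemma flat_gt0 k z : 0 < z -> flat k z = (flat_poly k).[z^-1] * expR (- z^-1).
Proof. by rewrite /flat => ->. Qed.

Lemma is_derive_flat k (z : R) : is_derive z 1 (flat k) (flat k.+1 z).
Proof.
have [z0|z0|z0] := ltgtP z 0.
- rewrite (flat_le0 _ (ltW z0)).
  apply: (@near_eq_is_derive _ _ _ (cst 0)).
  near=> y; rewrite flat_le0// ltW//.
  by near: y; exact: lt_nbhsl.
- rewrite (flat_gt0 _ z0).
  pose F y := (flat_poly k).[y^-1] * expR (- y^-1).
  apply: (@near_eq_is_derive _ _ _ F).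
    near=> y; rewrite flat_gt0//; near: y; exact: lt_nbhsr.
  have zN0 : z != 0 by rewrite lt0r_neq0.
  have Di : is_derive z 1 (fun y : R => y^-1) (- z ^- 2).
    by have := @is_deriveV R id z 1 1 zN0 (is_derive_id _ _); rewrite /GRing.scale /= mulr1.
  have Dp := @is_derive1_comp R (horner (flat_poly k)) (fun y : R => y^-1) z _ _ (is_derive_poly _ _) Di.
  have Dn : is_derive z 1 (fun y : R => - y^-1) (z ^- 2).
    by have := is_deriveN Di; rewrite opprK.
  have De := @is_derive1_comp R expR (fun y : R => - y^-1) z _ _ (is_derive_expR _) Dn.
  refine (@is_derive_eq _ _ _ F z 1 _ _ (is_deriveM Dp De) _).
  have -> : (flat_poly k.+1).[z^-1] = z ^- 2 * ((flat_poly k).[z^-1] - (flat_poly k)^`().[z^-1]).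
    by rewrite -exprVn /= hornerM hornerXn hornerD hornerN.
  by rewrite /= /GRing.scale /=; ring.
- rewrite z0 (flat_le0 _ (lexx 0)).
  have [C C0 HC] := horner_exp_bound (flat_poly k).
  suff D : (fun h => h^-1 *: ((flat k \o shift 0) (h *: 1) - flat k 0)) @ 0^' --> (0 : R).
    by split; [exact: cvgP D|exact: cvg_lim D].
  apply: (@cvg_to_0_linear _ _ C 1 ltr01) => h /andP[h0 h1].
  rewrite /= addr0 [h%:A]mulr1 (flat_le0 _ (lexx 0)) subr0 /flat.
  case: ifPn => [hp|_]; last by rewrite scaler0 normr0 mulr_ge0.
  rewrite gtr0_norm// in h0 h1.
  rewrite normrZ normfV (gtr0_norm hp) ler_pdivrMl//.
  apply: le_trans (HC h^-1 _) _; first by rewrite invf_ge1// ltW.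
  by rewrite exprVn invrK expr2 mulrCA.
Unshelve. all: by end_near. Qed.

Lemma flat_ge0 z : 0 <= flat 0 z.
Proof. by rewrite /flat; case: ifP => // _; rewrite hornerE mul1r expR_ge0. Qed.

Lemma flat0E z : 0 < z -> flat 0 z = expR (- z^-1).
Proof. by rewrite /flat => ->; rewrite hornerE mul1r. Qed.

Lemma flat1_ge0 z : 0 <= flat 1 z.
Proof.
rewrite /flat; case: ifP => // z0; rewrite mulr_ge0 ?expR_ge0//.
by rewrite /flat_poly /= !hornerE derivC hornerE subr0 mulr1 exprn_even_ge0.
Qed.

Lemma flat1_le4 z : flat 1 z <= 4.
Proof.
rewrite /flat; case: ifP => // z0.
rewrite /flat_poly /= !hornerE derivC hornerE subr0 mulr1.
rewrite expRN ler_pdivrMr ?expR_gt0//.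
have := @exprn_le_expR 2 z^-1; rewrite invr_ge0 ltW// => /(_ isT).
by rewrite -natrX.
Qed.

Definition step (z : R) : R := flat 0 z / (flat 0 z + flat 0 (1 - z)).

(** Quotient rule after cancellation of the terms [flat 1 z * flat 0 z]; in this form nonnegativity
    is visible. *)
Definition step' (z : R) : R :=
  (flat 1 z * flat 0 (1 - z) + flat 0 z * flat 1 (1 - z))
    / (flat 0 z + flat 0 (1 - z)) ^+ 2.

(** One of z and 1 - z is at least 1/2, where exp(-1/z) >= exp(-2). *)
Lemma step_den_ge z : expR (-2) <= flat 0 z + flat 0 (1 - z).
Proof.
wlog zh : z / 2^-1 <= z.
  move=> H; have [|zh] := leP 2^-1 z; first exact: H.
  by rewrite addrC -{2}(subKr 1 z); apply: H; lra.
rewrite (@le_trans _ _ (flat 0 z))// ?lerDl ?flat_ge0//.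
have z0 : 0 < z by lra.
rewrite flat0E// ler_expR lerN2 -[leRHS]invrK lef_pV2 ?posrE//.
Qed.

Lemma step_den_gt0 z : 0 < flat 0 z + flat 0 (1 - z).
Proof. exact: lt_le_trans (expR_gt0 _) (step_den_ge z). Qed.

Lemma is_derive_step (z : R) : is_derive z 1 step (step' z).
Proof.
have D1 := is_derive_flat 0 z.
have Dl : is_derive z 1 (fun z : R => 1 - z) (-1).
  by refine (is_derive_eq (is_deriveB (is_derive_cst (1 : R) z (1 : R)) (is_derive_id z (1 : R))) _); rewrite sub0r.
have D2 := @is_derive1_comp R (flat 0) (fun z : R => 1 - z) z _ _ (is_derive_flat 0 (1 - z)) Dl.
have D3 := is_deriveD D1 D2.
have dn : (flat 0 + (flat 0 \o (fun z : R => 1 - z))) z != 0.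
  by rewrite lt0r_neq0// step_den_gt0.
have D4 := is_deriveV dn D3.
refine (@is_derive_eq _ _ _ step z 1 _ _ (is_deriveM D1 D4) _).
have := step_den_gt0 z.
rewrite /step' /= /GRing.scale /= -[(_ + _ : R -> R) z]/(flat 0 z + flat 0 (1 - z)).
set a := flat 0 z; set b := flat 0 (1 - z) => ab.
by field; rewrite lt0r_neq0.
Qed.

Lemma step_le0 z : z <= 0 -> step z = 0.
Proof. by move=> z0; rewrite /step flat_le0// mul0r. Qed.

Lemma step_ge1 z : 1 <= z -> step z = 1.
Proof.
move=> z1; have := step_den_gt0 z; rewrite /step (@flat_le0 0 (1 - z)) ?subr_le0//.
by rewrite addr0 => p; rewrite divff// lt0r_neq0.
Qed.

Lemma step_ge0 z : 0 <= step z.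
Proof. by rewrite divr_ge0// ?flat_ge0// ltW// step_den_gt0. Qed.

Lemma step_le1 z : step z <= 1.
Proof. by rewrite ler_pdivrMr ?step_den_gt0// mul1r lerDl flat_ge0. Qed.

Lemma step'_ge0 z : 0 <= step' z.
Proof.
by rewrite divr_ge0// ?exprn_even_ge0// addr_ge0// mulr_ge0// ?flat_ge0 ?flat1_ge0.
Qed.

Lemma step'_eq0 z : ~~ (0 < z < 1) -> step' z = 0.
Proof.
rewrite negb_and -!leNgt /step' => /orP[z0|z1].
  by rewrite !(flat_le0 _ z0) !mul0r addr0 mul0r.
by rewrite !(@flat_le0 _ (1 - z)) ?subr_le0// !mulr0 addr0 mul0r.
Qed.

Lemma flat0_le1 z : flat 0 z <= 1.
Proof.
have [z0|z0] := leP z 0; first by rewrite flat_le0.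
by rewrite flat0E// -[leRHS]expR0 ler_expR oppr_le0 invr_ge0 ltW.
Qed.

(** The numerator is at most 4 + 4 and the squared denominator at least exp(-4). The logarithm ln 8
    + 4 reappears in the bound on the source. *)
Lemma step'_bound z : step' z <= 8 * expR 4.
Proof.
rewrite ler_pdivrMr ?exprn_gt0 ?step_den_gt0//.
apply: (@le_trans _ _ 8).
  have -> : (8 : R) = 4 * 1 + 1 * 4 by ring.
  by apply: lerD; apply: ler_pM; rewrite ?flat_ge0 ?flat1_ge0 ?flat0_le1 ?flat1_le4.
rewrite -mulrA ler_peMr//.
apply: (@le_trans _ _ (expR 4 * expR (-2) ^+ 2)).
  by rewrite -expRM_natl -expRD (_ : _ + _ = 0) ?expR0//; ring.
rewrite ler_wpM2l ?expR_ge0//; apply: lerXn2r; rewrite ?nnegrE ?expR_ge0//.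
  exact/ltW/step_den_gt0.
exact: step_den_ge.
Qed.

Lemma Ck_step (V : normedModType R) k (U : set V) f : open U -> Ck k U f ->
  Ck k U (fun p => step (f p)).
Proof.
move=> oU Cf.
have C1 : Ck k U (fun p => 1 - f p).
  by apply: Ck_add => //; [exact: Ck_cst|apply: eq_Ck (Ck_scale (-1) oU Cf) => // p _; rewrite mulN1r].
have D i (z : R) : setT z -> is_derive z 1 (flat i) (flat i.+1 z).
  by move=> _; exact: is_derive_flat.
have F1 := @Ck_comp R V k U f setT flat 0 oU (fun _ _ => Logic.I) D Cf.
have F2 := @Ck_comp R V k U (fun p => 1 - f p) setT flat 0 oU (fun _ _ => Logic.I) D C1.
apply: (Ck_mul oU F1); apply: Ck_inv => //; last exact: (Ck_add oU F1 F2).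
by move=> p _; rewrite lt0r_neq0// step_den_gt0.
Qed.

End cutoff.

(** * The heat kernel *)

Section heat.
Context {R : realType} {n : nat}.
Local Notation V := ('rV[R]_n * R)%type.
Implicit Types (p v : V) (c : R).

Lemma is_derive_chain (h : R -> R) (f : V -> R) p v (dh df : R) :
  is_derive (f p) 1 h dh -> is_derive p v f df ->
  is_derive p v (h \o f) (dh * df).
Proof. by move=> dhP [d <-]; exact: is_derive_comp1. Qed.

Lemma is_derive_linear (f : V -> R) p v :
  (forall (s : R) q w, f (s *: w + q) = s * f w + f q) -> is_derive p v f (f v).
Proof.
move=> lf.
suff D : (fun h => h^-1 *: ((f \o shift p) (h *: v) - f p)) @ 0^' --> f v.
  by split; [exact: cvgP D|exact: cvg_lim D].
apply: cvg_near_cst; rewrite near_withinE; near=> h => h0.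
by rewrite /= lf addrK /GRing.scale /= mulKf.
Unshelve. all: by end_near. Qed.

Lemma is_derive_snd p v : is_derive p v (fun q => q.2) v.2.
Proof. exact: (@is_derive_linear (fun q => q.2)). Qed.

Lemma is_derive_coord (i : 'I_n) p v : is_derive p v (fun q => q.1 0 i) (v.1 0 i).
Proof. by apply: (@is_derive_linear (fun q => q.1 0 i)) => s q w; rewrite /= !mxE. Qed.

Lemma continuous_snd : continuous (fun p => p.2).
Proof. by move=> p; exact: cvg_snd. Qed.

Lemma continuous_coord (i : 'I_n) : continuous (fun p => p.1 0 i).
Proof.
move=> p; apply: (@continuous_comp _ _ _ fst (fun x : 'rV[R]_n => x 0 i)).
  exact: cvg_fst.
exact: coord_continuous.
Qed.

Lemma open_snd_gt (a : R) : open [set p : V | a < p.2].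
Proof.
apply: (@open_comp _ _ (snd : V -> R) [set t | a < t]); last exact: open_gt.
by move=> p _; exact: continuous_snd.
Qed.

Lemma open_snd_lt (a : R) : open [set p : V | p.2 < a].
Proof.
apply: (@open_comp _ _ (snd : V -> R) [set t | t < a]); last exact: open_lt.
by move=> p _; exact: continuous_snd.
Qed.

Lemma Ck_snd k (U : set V) : open U -> Ck k U (fun p => p.2).
Proof.
move=> oU; apply: Ck_affine => //; first exact: continuous_snd.
by move=> v; exists v.2 => q; exact: is_derive_snd.
Qed.

Lemma Ck_coord k (U : set V) i : open U -> Ck k U (fun p => p.1 0 i).
Proof.
move=> oU; apply: Ck_affine => //; first exact: continuous_coord.
by move=> v; exists (v.1 0 i) => q; exact: is_derive_coord.
Qed.

(** A single exponential: smoothness becomes a composition, and comparisons of kernels become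
    inequalities between exponents. *)
Lemma heat_kernelE (x : 'rV[R]_n) (t : R) : 0 < t ->
  heat_kernel x t = expR (- (n%:R / 2) * ln (4 * pi * t) - sqnorm x * (4 * t)^-1).
Proof.
move=> t0; rewrite /heat_kernel t0 /powR.
have p0 : 0 < 4 * pi * t by rewrite !mulr_gt0// pi_gt0.
by rewrite gt_eqF// -expRD.
Qed.

Lemma heat_kernel_ge0 (x : 'rV[R]_n) (t : R) : 0 <= heat_kernel x t.
Proof.
by rewrite /heat_kernel; case: ifP => // _; rewrite mulr_ge0 ?powR_ge0 ?expR_ge0.
Qed.

Lemma Ck_heat_kernel k c : Ck k [set p : V | - c < p.2] (fun p => heat_kernel p.1 (p.2 + c)).
Proof.
have oU := @open_snd_gt (- c); set U := [set p : V | _] in oU *.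
have pos p : U p -> 0 < p.2 + c by rewrite /U /= -subr_gt0 opprK.
have Ct : Ck k U (fun p => p.2 + c).
  by apply: Ck_add => //; [exact: Ck_snd|exact: Ck_cst].
pose E p := - (n%:R / 2) * ln (4 * pi * (p.2 + c)) + (-1) * (sqnorm p.1 * (4 * (p.2 + c))^-1).
apply: (@eq_Ck _ _ _ _ (fun p => expR (E p))) => //.
  by move=> p Up; rewrite heat_kernelE ?pos// /E mulN1r.
apply: Ck_exp => //; apply: Ck_add => //; apply: Ck_scale => //.
  apply: Ck_ln => //; last exact: Ck_scale.
  by move=> p Up; rewrite !mulr_gt0 ?pi_gt0// pos.
apply: Ck_mul => //.
  apply: Ck_sum => // i; apply: (@eq_Ck _ _ _ _ (fun p => p.1 0 i * p.1 0 i)) => //.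
  by apply: Ck_mul => //; exact: Ck_coord.
apply: Ck_inv => //; last exact: Ck_scale.
by move=> p Up; rewrite lt0r_neq0// mulr_gt0// pos.
Qed.

Lemma is_derive_sqnorm p v :
  is_derive p v (fun q => sqnorm q.1) (\sum_(i < n) 2 * p.1 0 i * v.1 0 i).
Proof.
have -> : (fun q : V => sqnorm q.1) = \sum_(i < n) (fun q : V => (q.1 0 i) ^+ 2).
  by apply/funext => q; rewrite fct_sumE.
have D i : is_derive p v (fun q : V => (q.1 0 i) ^+ 2) (2 * p.1 0 i * v.1 0 i).
  refine (is_derive_eq (is_deriveM (is_derive_coord i p v) (is_derive_coord i p v)) _).
  by rewrite /GRing.scale /=; ring.
exact: is_derive_sum.
Qed.

(** The factor next to the kernel is the derivative of the exponent in [heat_kernelE]. *)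
Lemma is_derive_heat_kernel c p v : 0 < p.2 + c ->
  is_derive p v (fun q => heat_kernel q.1 (q.2 + c))
    (heat_kernel p.1 (p.2 + c) *
      (- (n%:R / 2) * (v.2 / (p.2 + c)) -
       ((\sum_(i < n) 2 * p.1 0 i * v.1 0 i) / (4 * (p.2 + c))
        - sqnorm p.1 * v.2 / (4 * (p.2 + c) ^+ 2)))).
Proof.
set t := p.2 + c => t0; have tN0 : t != 0 by rewrite lt0r_neq0.
have pi0 : (pi : R) != 0 by rewrite lt0r_neq0// pi_gt0.
have Dt : is_derive p v (fun q => q.2 + c) v.2.
  refine (is_derive_eq (is_deriveD (is_derive_snd p v) (is_derive_cst c p v)) _).
  by rewrite addr0.
have Dl : is_derive p v (fun q => ln (4 * pi * (q.2 + c))) (v.2 / t).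
  refine (is_derive_eq (is_derive_chain (h := fun y => ln (4 * pi * y)) (dh := t^-1) _ Dt) (mulrC _ _)).
  rewrite -/t.
  have D1 : is_derive t 1 (fun y : R => 4 * pi * y) (4 * pi).
    by refine (is_derive_eq (is_deriveZ (4 * pi) (is_derive_id t (1 : R))) _); rewrite /GRing.scale /= mulr1.
  have p0 : 0 < 4 * pi * t by rewrite !mulr_gt0// pi_gt0.
  refine (is_derive_eq (is_derive1_comp (g := fun y : R => 4 * pi * y) (is_derive1_ln p0) D1) _).
  by move: pi0; move: (pi : R) => q pi0; field; rewrite tN0 pi0.
have Di : is_derive p v (fun q => (4 * (q.2 + c))^-1) (- v.2 / (4 * t ^+ 2)).
  rewrite mulNr -mulrN mulrC.
  apply: (is_derive_chain (h := fun y => (4 * y)^-1) _ Dt); rewrite -/t.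
  have D1 : is_derive t 1 (fun y : R => 4 * y) 4.
    by refine (is_derive_eq (is_deriveZ 4 (is_derive_id t (1 : R))) _); rewrite /GRing.scale /= mulr1.
  have f0 : 4 * t != 0 by rewrite mulf_neq0.
  refine (is_derive_eq (is_deriveV (f := fun y : R => 4 * y) f0 D1) _).
  by rewrite /GRing.scale /=; field.
have DE := is_deriveB (is_deriveZ (- (n%:R / 2)) Dl) (is_deriveM (is_derive_sqnorm p v) Di).
have De := is_derive_chain (is_derive_expR _) DE.
apply: (@near_eq_is_derive _ _ _ (expR \o (((- (n%:R / 2)) *: (fun q : V => ln (4 * pi * (q.2 + c)))) -
   ((fun q : V => sqnorm q.1) * (fun q : V => (4 * (q.2 + c))^-1))))).
  near=> q; rewrite heat_kernelE//.
  have : [set q : V | - c < q.2] q.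
    by near: q; apply: open_nbhs_nbhs; split; [exact: open_snd_gt|rewrite /= -subr_gt0 opprK].
  by rewrite /= -subr_gt0 opprK.
refine (is_derive_eq De _).
rewrite heat_kernelE// -/t; congr (_ * _); rewrite /GRing.scale /=.
set s := \sum_(i < n) _; set S := sqnorm _.
by field.
Unshelve. all: by end_near. Qed.

End heat.

(** * Heat kernels switched on by a step, and their heat operator *)

Section heat_bumps.
Context {R : realType} {n : nat}.
Local Notation V := ('rV[R]_n * R)%type.
Implicit Types (p v : V) (T r : R).

(** The offset 5 exceeds the switching offset 4 by one: wherever the step is nonzero the kernel has
    age more than r^2, so its singularity is cut away. *)
Definition heat_bump T r p : R :=
  step ((p.2 - T) / r ^+ 2 + 4) * heat_kernel p.1 (p.2 + (5 * r ^+ 2 - T)).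

Lemma heat_bump_ge0 T r p : 0 <= heat_bump T r p.
Proof. by rewrite mulr_ge0 ?step_ge0 ?heat_kernel_ge0. Qed.

Lemma heat_bump_eq0 T r p : 0 < r -> p.2 <= T - 4 * r ^+ 2 -> heat_bump T r p = 0.
Proof.
move=> r0 pT; rewrite /heat_bump step_le0 ?mul0r//.
rewrite -[leRHS](addNr (4 : R)) lerD2r ler_pdivrMr ?exprn_gt0//; lra.
Qed.

Lemma Ck_stepz k (U : set V) T r : open U -> Ck k U (fun p => step ((p.2 - T) / r ^+ 2 + 4)).
Proof.
move=> oU; apply: Ck_step => //; apply: Ck_add => //; last exact: Ck_cst.
apply: Ck_mul => //; last exact: Ck_cst.
by apply: Ck_add => //; [exact: Ck_snd|exact: Ck_cst].
Qed.

(** Two overlapping open half-spaces: on one the kernel is smooth, on the other the bump vanishes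
    identically. *)
Lemma heat_bump_cover T r p : 0 < r ->
  - (5 * r ^+ 2 - T) < p.2 \/ p.2 < T - 4 * r ^+ 2.
Proof.
move=> r0; have r2 : 0 < r ^+ 2 by rewrite exprn_gt0.
by have [?|?] := ltP p.2 (T - 4 * r ^+ 2); [right|left; lra].
Qed.

Lemma Ck_bump k T r : 0 < r -> Ck k setT (heat_bump T r).
Proof.
move=> r0.
apply: (@Ck_sub _ _ _ ([set p : V | - (5 * r ^+ 2 - T) < p.2] `|` [set p : V | p.2 < T - 4 * r ^+ 2])).
  by move=> p _; exact: heat_bump_cover.
have o1 := @open_snd_gt R n (- (5 * r ^+ 2 - T)).
have o2 := @open_snd_lt R n (T - 4 * r ^+ 2).
apply: Ck_setU.
  by apply: Ck_mul => //; [exact: Ck_stepz|exact: Ck_heat_kernel].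
apply: (@eq_Ck _ _ _ _ (cst 0)) => //; last exact: Ck_cst.
by move=> p /= /ltW pT; rewrite heat_bump_eq0.
Qed.

Lemma is_derive_bump T r p v : 0 < r -> 0 < p.2 + (5 * r ^+ 2 - T) ->
  is_derive p v (heat_bump T r)
    (step' ((p.2 - T) / r ^+ 2 + 4) * (v.2 / r ^+ 2) * heat_kernel p.1 (p.2 + (5 * r ^+ 2 - T))
     + heat_bump T r p *
      (- (n%:R / 2) * (v.2 / (p.2 + (5 * r ^+ 2 - T))) -
       ((\sum_(i < n) 2 * p.1 0 i * v.1 0 i) / (4 * (p.2 + (5 * r ^+ 2 - T)))
        - sqnorm p.1 * v.2 / (4 * (p.2 + (5 * r ^+ 2 - T)) ^+ 2)))).
Proof.
move=> r0; set c := 5 * r ^+ 2 - T => t0.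
have Dz : is_derive p v (fun q => (q.2 - T) / r ^+ 2 + 4) (v.2 / r ^+ 2).
  have D1 := is_deriveB (is_derive_snd p v) (is_derive_cst T p v).
  have D2 := is_deriveM D1 (is_derive_cst (r ^- 2) p v).
  refine (is_derive_eq (is_deriveD D2 (is_derive_cst (4 : R) p v)) _).
  by rewrite /GRing.scale /= /cst; ring.
have Ds := is_derive_chain (is_derive_step _) Dz.
refine (is_derive_eq (is_deriveM Ds (is_derive_heat_kernel v t0)) _).
by rewrite /GRing.scale /= /heat_bump -/c; ring.
Qed.

Lemma is_derive_bump_space T r p i : 0 < r -> 0 < p.2 + (5 * r ^+ 2 - T) ->
  is_derive p (evec R i, (0 : R)) (heat_bump T r)
    (heat_bump T r p * (- p.1 0 i / (2 * (p.2 + (5 * r ^+ 2 - T))))).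
Proof.
move=> r0 t0; refine (is_derive_eq (is_derive_bump (evec R i, 0) r0 t0) _).
rewrite /= (bigD1 i)//= big1 ?addr0; last first.
  by move=> j ji; rewrite mxE eqxx (negbTE ji) /= mulr0.
rewrite mxE !eqxx /=.
set t := p.2 + _ in t0 *; set h := heat_kernel _ _; set b := heat_bump _ _ _; set s := step' _.
by field; rewrite !lt0r_neq0.
Qed.

Lemma is_derive_bump_space2 T r p i : 0 < r -> 0 < p.2 + (5 * r ^+ 2 - T) ->
  is_derive p (evec R i, (0 : R)) ('D_(evec R i, (0 : R)) (heat_bump T r))
    (heat_bump T r p * ((p.1 0 i) ^+ 2 / (4 * (p.2 + (5 * r ^+ 2 - T)) ^+ 2)
                   - (2 * (p.2 + (5 * r ^+ 2 - T)))^-1)).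
Proof.
move=> r0 t0; set c := 5 * r ^+ 2 - T in t0 *.
have D1 := is_derive_bump_space i r0 t0; rewrite -/c in D1.
have D2 : is_derive p (evec R i, (0 : R)) (fun q : V => - q.1 0 i / (2 * (q.2 + c))) (- (2 * (p.2 + c))^-1).
  set f := fun q : V => _.
  suff D : (fun h => h^-1 *: ((f \o shift p) (h *: (evec R i, (0 : R))) - f p)) @ 0^' --> (- (2 * (p.2 + c))^-1).
    by split; [exact: cvgP D|exact: cvg_lim D].
  apply: cvg_near_cst; rewrite near_withinE; near=> h => h0.
  rewrite /f /= !mxE !eqxx /= mulr1 [h *: 0]mulr0 add0r /GRing.scale /=.
  by field; rewrite lt0r_neq0.
refine (near_eq_is_derive _ _); last first.
  refine (is_derive_eq (is_deriveM D1 D2) _).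
  by rewrite /GRing.scale /=; field; rewrite lt0r_neq0.
near=> q; have qU : [set q : V | - c < q.2] q.
  by near: q; apply: open_nbhs_nbhs; split; [exact: open_snd_gt|rewrite /= -subr_gt0 opprK].
have q0 : 0 < q.2 + c by move: qU; rewrite /= -subr_gt0 opprK.
by have [_ ->] := is_derive_bump_space i r0 q0.
Unshelve. all: by end_near. Qed.

Lemma heat_op_iter_der (U : V -> R) p :
  heat_op U p = iter_der [:: ((0 : 'rV[R]_n), (1 : R))] U p -
    \sum_(i < n) iter_der [:: (evec R i, (0 : R)); (evec R i, (0 : R))] U p.
Proof. by []. Qed.

Lemma heat_op_bump T r p : 0 < r -> heat_op (heat_bump T r) p =
  step' ((p.2 - T) / r ^+ 2 + 4) / r ^+ 2 * heat_kernel p.1 (p.2 + (5 * r ^+ 2 - T)).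
Proof.
move=> r0; have r2 : 0 < r ^+ 2 by rewrite exprn_gt0.
have [pT|pT] := @heat_bump_cover T r p r0; last first.
  rewrite step'_eq0; last first.
    rewrite negb_and -!leNgt; apply/orP; left.
    by rewrite -[leRHS](addNr (4 : R)) lerD2r ler_pdivrMr//; lra.
  have E vs := @eq_iter_der _ _ _ (heat_bump T r) (cst 0) vs (@open_snd_lt R n (T - 4 * r ^+ 2)) (fun q qT => heat_bump_eq0 r0 (ltW qT)) p pT.
  rewrite heat_op_iter_der E big1 => [|i _]; first by rewrite /= derive_cst subr0 !mul0r.
  rewrite E /= (_ : 'D_(evec R i, (0 : R)) (cst (0 : R)) = cst 0) ?derive_cst//.
  by apply/funext => q; rewrite derive_cst.
have t0 : 0 < p.2 + (5 * r ^+ 2 - T) by rewrite -subr_gt0 opprK in pT.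
rewrite /heat_op.
have [_ ->] := is_derive_bump ((0 : 'rV[R]_n), (1 : R)) r0 t0.
rewrite (eq_bigr _ (fun i _ => @derive_val _ _ _ _ _ _ _ (is_derive_bump_space2 i r0 t0))).
rewrite /= -mulr_sumr sumrB -mulr_suml sumr_const card_ord.
rewrite big1; last by move=> i _; rewrite mxE mulr0.
(* The sum of second derivatives, S/(4t^2) - n/(2t) times the bump, cancels the kernel part of the
   time derivative; only the derivative of the step is left. *)
rewrite -[\sum_(i < n) (p.1 0 i) ^+ 2]/(sqnorm p.1) -mulr_natr.
set t := p.2 + _ in t0 *; set S := sqnorm _.
by field; rewrite !lt0r_neq0.
Qed.

End heat_bumps.

(** * The tower of bumps *)

Section construction.
Context {R : realType} {n : nat}.
Local Notation V := ('rV[R]_n * R)%type.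
Variables (q r0 ep : R) (K : nat -> nat).
Hypotheses (q0 : 0 < q) (q4 : q <= 4^-1) (r00 : 0 < r0) (r01 : r0 < 1) (ep0 : 0 < ep).

(** Geometric in both indices: a double sum of powers of the radii factors into two geometric
    series. *)
Definition scale j k : R := r0 * q ^+ (j + k).
Definition peak j : R := scale j 0 ^+ 2.
Definition mass j k : R := scale j k `^ ep.
(* The window of the term k = 0 lies in t < 0, hence that term is a genuine heat
   kernel for t > 0 and serves as background for the terms k > 0. *)
Definition chain j (p : V) : R :=
  \sum_(k < (K j).+1) mass j k * heat_bump (peak j) (scale j k) p.
Definition chain_mass j : R := \sum_(k < (K j).+1) mass j k.
Definition tower (p : V) : R := limn (series (fun j => chain j p)).

Let q1 : q < 1. Proof. by move: q4; lra. Qed.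

Lemma scale_gt0 j k : 0 < scale j k.
Proof. by rewrite mulr_gt0// exprn_gt0. Qed.

Lemma scaleS j k : scale j k.+1 = q * scale j k.
Proof. by rewrite /scale addnS exprS mulrCA. Qed.

Lemma scale_lt1 j k : scale j k < 1.
Proof.
apply: le_lt_trans r01; rewrite /scale ler_piMr ?(ltW r00)// exprn_ile1 ?ltW//.
Qed.

Lemma scale_le j k k' : (k <= k')%N -> scale j k' <= scale j k.
Proof.
by move=> kk; rewrite /scale ler_pM2l// ler_wiXn2l ?ltW// leq_add2l.
Qed.

Lemma peak_gt0 j : 0 < peak j.
Proof. by rewrite exprn_gt0// scale_gt0. Qed.

Lemma scale2_le_peak j k : scale j k ^+ 2 <= peak j.
Proof. by apply: lerXn2r; rewrite ?nnegrE ?(ltW (scale_gt0 _ _))// scale_le. Qed.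

(** This is what q <= 1/4 is for: the factor 16 separates the windows within a chain and, via
    [peakS], those of different chains. *)
Lemma scale2S j k : scale j k.+1 ^+ 2 <= scale j k ^+ 2 / 16.
Proof.
rewrite scaleS exprMn mulrC ler_wpM2l ?exprn_ge0 ?(ltW (scale_gt0 _ _))//.
have -> : 16^-1 = (4^-1) ^+ 2 :> R by field.
by apply: lerXn2r; rewrite ?nnegrE// ltW.
Qed.

Lemma peakS j : peak j.+1 <= peak j / 16.
Proof. by have := scale2S j 0; rewrite /peak /scale addSn addn0 addn1. Qed.

Lemma peak_lt1 j : peak j < 1.
Proof. by rewrite exprn_ilt1// ?scale_lt1// ltW// scale_gt0. Qed.

Lemma peak_le j j' : (j <= j')%N -> peak j' <= peak j.
Proof.
move=> jj; apply: lerXn2r; rewrite ?nnegrE ?(ltW (scale_gt0 _ _))//.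
by rewrite /scale ler_pM2l// ler_wiXn2l ?ltW// leq_add2r.
Qed.

Lemma cvg_peak : peak j @[j --> \oo] --> 0.
Proof.
have -> : peak = geometric (r0 ^+ 2) (q ^+ 2).
  by apply/funext => j; rewrite /peak /scale addn0 exprMn /geometric /= -!exprM mulnC.
apply: cvg_geometric; rewrite ger0_norm ?exprn_ge0 ?ltW// exprn_ilt1// ltW//.
Qed.

Lemma powR_exprn (y : R) (m : nat) (ka : R) : 0 <= y -> (y ^+ m) `^ ka = (y `^ ka) ^+ m.
Proof.
by move=> y0; rewrite -(powR_mulrn _ y0) -powRrM mulrC powRrM powR_mulrn// powR_ge0.
Qed.

Lemma scale_powR_le (ka : R) j k : 0 < ka ->
  scale j k `^ ka <= (q `^ ka) ^+ j * (q `^ ka) ^+ k.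
Proof.
move=> ka0; rewrite -exprD -(powR_exprn _ _ (ltW q0)) ge0_ler_powR//; first exact: ltW.
- by rewrite nnegrE ltW// scale_gt0.
- by rewrite nnegrE exprn_ge0// ltW.
by rewrite /scale ler_piMl// ?exprn_ge0// ltW.
Qed.

Lemma powR_q_lt1 (ka : R) : 0 < ka -> 0 <= q `^ ka < 1.
Proof.
move=> ka0; rewrite powR_ge0/= -[ltRHS]/((fun=> 1) ka) -powR1.
by rewrite gt0_ltr_powR// nnegrE ?ltW.
Qed.

Lemma geometric_sum_le (y : R) N : 0 <= y < 1 -> \sum_(k < N) y ^+ k <= (1 - y)^-1.
Proof.
move=> /andP[y0 y1]; have d0 : 0 < 1 - y by rewrite subr_gt0.
rewrite -(ler_pM2l d0) divff ?lt0r_neq0// -opprB mulNr -subrX1 opprB.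
by rewrite gerBl exprn_ge0.
Qed.

(** Uniform in [N], hence valid whatever the length of the chain. *)
Lemma sum_scale_powR_le (ka : R) j N : 0 < ka ->
  \sum_(k < N) scale j k `^ ka <= (1 - q `^ ka)^-1 * (q `^ ka) ^+ j.
Proof.
move=> ka0; have y := powR_q_lt1 ka0.
apply: (@le_trans _ _ (\sum_(k < N) (q `^ ka) ^+ j * (q `^ ka) ^+ k)).
  by apply: ler_sum => k _; exact: scale_powR_le.
rewrite -mulr_sumr mulrC ler_wpM2r ?exprn_ge0 ?powR_ge0//.
exact: geometric_sum_le.
Qed.

Lemma mass_gt0 j k : 0 < mass j k.
Proof. by rewrite powR_gt0// scale_gt0. Qed.

Lemma chain_mass_gt0 j : 0 < chain_mass j.
Proof.
rewrite /chain_mass big_ord_recl ltr_pwDl ?mass_gt0// sumr_ge0// => k _.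
exact/ltW/mass_gt0.
Qed.

Lemma cvg_chain_mass : cvgn (series chain_mass).
Proof.
have /andP[y0 y1] := powR_q_lt1 ep0.
apply: (@series_le_cvg _ _ (geometric (1 - q `^ ep)^-1 (q `^ ep))).
- by move=> j; exact/ltW/chain_mass_gt0.
- by move=> j; rewrite /geometric /= mulr_ge0 ?exprn_ge0// invr_ge0 subr_ge0 ltW.
- by move=> j; exact: sum_scale_powR_le.
by apply: is_cvg_geometric_series; rewrite ger0_norm.
Qed.

Lemma Ck_chain j k : Ck k setT (chain j).
Proof.
apply: Ck_sum => [|i]; first exact: openT.
by apply: Ck_scale; [exact: openT|apply: Ck_bump; exact: scale_gt0].
Qed.

Lemma iter_der_chain j (vs : seq V) (p : V) : iter_der vs (chain j) p =
  \sum_(k < (K j).+1) mass j k * iter_der vs (heat_bump (peak j) (scale j k)) p.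
Proof.
apply: (iter_der_sum _ _ _ openT) => // k i; apply: Ck_bump; exact: scale_gt0.
Qed.

(** * Convergence and smoothness of the tower *)

Let H (p : V) := heat_kernel p.1 (p.2 + 0).
Let U0 := [set p : V | 0 < p.2].

Let oU0 : open U0. Proof. exact: open_snd_gt. Qed.

(** Past its apex a bump is fully on, hence a time translate of the heat kernel; one local bound on
    [H] then serves all late chains. *)
Lemma iter_der_bump_late j k (vs : seq V) (p : V) : peak j < p.2 ->
  iter_der vs (heat_bump (peak j) (scale j k)) p
  = iter_der vs H (p + (0, 5 * scale j k ^+ 2 - peak j)).
Proof.
move=> jp; rewrite -iter_der_shift.
apply: (@eq_iter_der _ _ [set p : V | peak j < p.2]) => //; first exact: open_snd_gt.
move=> w /= jw; rewrite /heat_bump /H /= !addr0 step_ge1 ?mul1r//.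
rewrite (@le_trans _ _ 4) ?ler1n// lerDr divr_ge0 ?exprn_ge0 ?(ltW (scale_gt0 _ _))//.
by rewrite subr_ge0 ltW.
Qed.

Lemma continuous_iter_der_H (vs : seq V) (p : V) : U0 p -> {for p, continuous (iter_der vs H)}.
Proof.
move=> Up; have := @Ck_heat_kernel R n (size vs + 0) 0; rewrite oppr0 => C.
exact: (Ck_continuous (Ck_iter_der C)).
Qed.

Lemma near_bounded (f : V -> R) p : {for p, continuous f} ->
  \forall w \near p, `|f w| <= `|f p| + 1.
Proof.
move=> /cvgrPdist_le /(_ 1 ltr01); apply: filterS => w fw.
by have := ler_normD (f w - f p) (f p); rewrite subrK distrC; lra.
Qed.

(** Finitely many chains only: each is locally bounded, and its positive mass can be divided out. *)
Lemma chain_dominated_head (vs : seq V) (p : V) N : exists C,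
  \forall w \near p, forall j, (j < N)%N -> `|iter_der vs (chain j) w| <= C * chain_mass j.
Proof.
elim: N => [|N [C HC]]; first by exists 0; near=> w => j.
have cN : {for p, continuous (iter_der vs (chain N))}.
  exact: (Ck_continuous (@Ck_iter_der _ _ 0 setT vs _ (Ck_chain _ _))).
have HN := near_bounded cN; set M := _ + 1 in HN.
exists (`|C| + M / chain_mass N); near=> w => j; rewrite ltnS leq_eqVlt => /orP[/eqP->|jN].
  rewrite mulrDl divfK ?lt0r_neq0 ?chain_mass_gt0//.
  rewrite ler_wpDl ?mulr_ge0 ?(ltW (chain_mass_gt0 _))//; near: w; exact: HN.
have M0 : 0 <= M by rewrite addr_ge0.
rewrite mulrDl ler_wpDr//; first by rewrite mulr_ge0 ?divr_ge0 ?(ltW (chain_mass_gt0 _)).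
apply: (@le_trans _ _ (C * chain_mass j)); last by rewrite ler_wpM2r ?ler_norm ?(ltW (chain_mass_gt0 _)).
by move: j jN; near: w.
Unshelve. all: by end_near. Qed.

Lemma chain_dominated (vs : seq V) (p : V) : U0 p -> exists C,
  \forall w \near p, forall j, `|iter_der vs (chain j) w| <= C * chain_mass j.
Proof.
move=> Up; have Hb := near_bounded (@continuous_iter_der_H vs _ Up).
set M := _ + 1 in Hb; have M0 : 0 <= M by rewrite addr_ge0.
move/nbhs_ballP : Hb => [d /= d0 Hd].
(* The translation in time is at most 4 [peak j] < 4d/10, which with |p - w| < d/2 stays inside the
   ball of radius d; p.2/4 puts the apex before [w]. *)
have d' : 0 < Num.min (d / 10) (p.2 / 4) by rewrite lt_min !divr_gt0.
have [N _ HN] : \forall j \near \oo, peak j < Num.min (d / 10) (p.2 / 4).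
  have /cvgrPdist_lt /(_ _ d') := cvg_peak.
  by apply: filterS => j; rewrite sub0r normrN ger0_norm// ltW// peak_gt0.
have [C HC] := chain_dominated_head vs p N.
exists (`|C| + M); near=> w => j.
have cm0 := ltW (chain_mass_gt0 j).
have [jN|Nj] := ltnP j N.
  rewrite mulrDl ler_wpDr ?mulr_ge0//.
  apply: (@le_trans _ _ (C * chain_mass j)); last by rewrite ler_wpM2r ?ler_norm.
  by move: j jN {cm0}; near: w.
have /= := HN j Nj; rewrite lt_min => /andP[jd jp].
have wd : `|p - w| < d / 2 by near: w; apply: cvgr_dist_lt; [exact: cvg_id|rewrite divr_gt0].
have wp : p.2 / 2 < w.2.
  near: w; apply: (@open_nbhs_nbhs _ p [set w : V | p.2 / 2 < w.2]); split; first exact: open_snd_gt.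
  by rewrite /= ltr_pdivrMr// ltr_pMr// ltr1n.
have jw : peak j < w.2 by have Up' : 0 < p.2 := Up; lra.
rewrite mulrDl ler_wpDl ?mulr_ge0//.
rewrite iter_der_chain (le_trans (ler_norm_sum _ _ _))// mulr_sumr.
apply: ler_sum => k _; rewrite normrM (gtr0_norm (mass_gt0 _ _)) mulrC ler_wpM2r ?(ltW (mass_gt0 _ _))//.
rewrite iter_der_bump_late//; apply: Hd; rewrite -ball_normE /=.
have cb : `|5 * scale j k ^+ 2 - peak j| <= 4 * peak j.
  have := scale2_le_peak j k; have : 0 <= scale j k ^+ 2 by rewrite exprn_ge0 ?(ltW (scale_gt0 _ _)).
  by have := peak_gt0 j; rewrite ler_norml; lra.
rewrite opprD addrA (le_lt_trans (ler_normB _ _))//.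
have -> : `|((0 : 'rV[R]_n), (5 * scale j k ^+ 2 - peak j : R))| = `|5 * scale j k ^+ 2 - peak j|.
  by rewrite prod_normE /= normr0 max_r.
have pj := peak_gt0 j; lra.
Unshelve. all: by end_near. Qed.

Lemma cvg_chain p : U0 p -> cvgn (series (fun j => chain j p)).
Proof.
move=> Up; have [C /nbhs_singleton HC] := chain_dominated [::] Up.
by have [] := @dominated_series _ _ cvg_chain_mass _ C HC.
Qed.

Let CW j k : Ck k U0 (chain j).
Proof. exact: Ck_sub (Ck_chain j k). Qed.

Lemma Ck_tower k : Ck k U0 tower.
Proof.
exact: (@Ck_series _ _ _ oU0 chain chain_mass (fun j => ltW (chain_mass_gt0 j)) cvg_chain_mass CW chain_dominated k [::]).
Qed.

Lemma iter_der_tower (vs : seq V) (p : V) : U0 p ->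
  cvgn (series (fun j => iter_der vs (chain j) p)) /\
  iter_der vs tower p = limn (series (fun j => iter_der vs (chain j) p)).
Proof.
move=> Up; split.
  exact: (@cvg_iter_der_series _ _ _ chain chain_mass cvg_chain_mass chain_dominated).
exact: (@iter_der_series _ _ _ oU0 chain chain_mass cvg_chain_mass CW chain_dominated).
Qed.

Lemma lim_series_sum (I : Type) (r : seq I) (f : I -> nat -> R) :
  (forall i, cvgn (series (f i))) ->
  cvgn (series (fun j => \sum_(i <- r) f i j)) /\
  limn (series (fun j => \sum_(i <- r) f i j)) = \sum_(i <- r) limn (series (f i)).
Proof.
move=> cf; elim: r => [|i r [c l]].
  have -> : series (fun j => \sum_(i <- [::]) f i j) = cst 0; last first.
    have c0 : (cst (0 : R) : nat -> R) @ \oo --> (0 : R) by exact: cvg_cst.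
    by rewrite big_nil (cvg_lim _ c0)//; split => //; exact: cvgP c0.
  by apply/funext => m; rewrite /series /= big1// => j _; rewrite big_nil.
have -> : (fun j => \sum_(i0 <- i :: r) f i0 j) = f i + (fun j => \sum_(i0 <- r) f i0 j).
  by apply/funext => j; rewrite big_cons.
by split; [exact: is_cvg_seriesD|rewrite lim_seriesD// big_cons l].
Qed.

Lemma heat_op_chain j (p : V) : heat_op (chain j) p =
  \sum_(k < (K j).+1) mass j k * heat_op (heat_bump (peak j) (scale j k)) p.
Proof.
rewrite heat_op_iter_der iter_der_chain.
rewrite (eq_bigr _ (fun i _ => iter_der_chain j [:: (evec R i, (0 : R)); (evec R i, (0 : R))] p)).
rewrite exchange_big /= -sumrB; apply: eq_bigr => k _.
by rewrite -mulr_sumr -mulrBr.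
Qed.

Lemma heat_op_tower p : U0 p ->
  cvgn (series (fun j => heat_op (chain j) p)) /\
  heat_op tower p = limn (series (fun j => heat_op (chain j) p)).
Proof.
move=> Up.
pose vt := [:: ((0 : 'rV[R]_n), (1 : R))].
pose vx (i : 'I_n) := [:: (evec R i, (0 : R)); (evec R i, (0 : R))].
have [ct lt_] := iter_der_tower vt Up.
have [cx lx] := lim_series_sum (index_enum 'I_n) (fun i => (iter_der_tower (vx i) Up).1).
have -> : (fun j => heat_op (chain j) p) =
  (fun j => iter_der vt (chain j) p) - (fun j => \sum_(i < n) iter_der (vx i) (chain j) p).
  by apply/funext => j; rewrite heat_op_iter_der.
split; first exact: is_cvg_seriesB.
rewrite lim_seriesB// lx heat_op_iter_der lt_; congr (_ - _).
by apply: eq_bigr => i _; rewrite (iter_der_tower (vx i) Up).2.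
Qed.

Lemma chain_ge0 j p : 0 <= chain j p.
Proof. by apply: sumr_ge0 => k _; rewrite mulr_ge0 ?heat_bump_ge0 ?(ltW (mass_gt0 _ _)). Qed.

(** Source of all lower bounds below: positivity, the influence of a parent term, and the height at
    an apex. *)
Lemma tower_ge j k p : U0 p -> (k <= K j)%N ->
  mass j k * heat_bump (peak j) (scale j k) p <= tower p.
Proof.
move=> Up kK; apply: (@le_trans _ _ (chain j p)).
  rewrite /chain (bigD1 (Ordinal (kK : (k < (K j).+1)%N)))//= lerDl.
  by apply: sumr_ge0 => i _; rewrite mulr_ge0 ?heat_bump_ge0 ?(ltW (mass_gt0 _ _)).
apply: (@le_trans _ _ (series (fun j => chain j p) j.+1)).
  rewrite /series /= big_nat_recr//= lerDr sumr_ge0// => i _; exact: chain_ge0.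
apply: nondecreasing_cvgn_le; last exact: cvg_chain.
by apply: nondecreasing_series => i _ _; exact: chain_ge0.
Qed.

(* If S is the right-hand sum, then a j k <= de j k * S^(1/lam) / D for all j, k;
   this works for every lam > 0, without convexity or subadditivity. *)
Lemma powR_series_le (lam D : R) (N : nat -> nat) (a de : nat -> nat -> R) :
  0 < lam -> 0 < D ->
  (forall j k, 0 <= a j k) -> (forall j k, 0 < de j k) ->
  (forall m, \sum_(0 <= j < m) \sum_(k < N j) de j k <= D) ->
  cvgn (series (fun j => \sum_(k < N j) a j k)) ->
  ((limn (series (fun j => \sum_(k < N j) a j k)) `^ lam)%:E <=
    \sum_(j <oo) \sum_(k < N j) (D `^ lam * (a j k / de j k) `^ lam)%:E)%E.
Proof.
move=> l0 D0 a0 de0 deD ca.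
have Dl0 : 0 < D `^ lam by rewrite powR_gt0.
have t0 j k : 0 <= D `^ lam * (a j k / de j k) `^ lam by rewrite mulr_ge0 ?powR_ge0.
set S := (\sum_(j <oo) _)%E.
have S0 : (0 <= S)%E by apply: nneseries_ge0 => j _ _; apply: sume_ge0 => k _; rewrite lee_fin.
case ES : S S0 => [r| |] // S0; last by rewrite leey.
rewrite lee_fin; rewrite lee_fin in S0.
have term j (k : 'I_(N j)) : a j k <= (r `^ lam^-1 / D) * de j k.
  have : D `^ lam * (a j k / de j k) `^ lam <= r.
    rewrite -lee_fin -ES.
    apply: (@le_trans _ _ (\sum_(0 <= i < j.+1) \sum_(k < N i) (D `^ lam * (a i k / de i k) `^ lam)%:E)%E); last first.
      by apply: nneseries_lim_ge => i _ _; apply: sume_ge0 => l _; rewrite lee_fin.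
    rewrite big_nat_recr//= (bigD1 k)//=.
    rewrite addeA (addeC (\sum_(0 <= i < j) _)%E) -addeA leeDl//.
    by rewrite adde_ge0// sume_ge0// => i _; rewrite ?sume_ge0// => *; rewrite lee_fin.
  rewrite -powRM ?divr_ge0 ?(ltW D0) ?(ltW (de0 _ _))// => Hr.
  have x0 : 0 <= D * (a j k / de j k) by rewrite mulr_ge0 ?divr_ge0 ?(ltW D0) ?(ltW (de0 _ _)).
  have : D * (a j k / de j k) <= r `^ lam^-1.
    rewrite -[leLHS](powRr1 x0) -(@divff _ lam) ?lt0r_neq0// powRrM.
    by rewrite ge0_ler_powR ?nnegrE ?powR_ge0 ?invr_ge0 ?(ltW l0).
  rewrite -ler_pdivlMl// ler_pdivrMr// => Hr2.
  by apply: le_trans Hr2 _; rewrite [D^-1 * _]mulrC.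
have rl0 : 0 <= r `^ lam^-1 by exact: powR_ge0.
have lim_le : limn (series (fun j => \sum_(k < N j) a j k)) <= r `^ lam^-1.
  apply: limr_le => //; apply: nearW => m; rewrite /series /=.
  apply: (@le_trans _ _ ((r `^ lam^-1 / D) * \sum_(0 <= j < m) \sum_(k < N j) de j k)).
    rewrite mulr_sumr; apply: ler_sum => j _; rewrite mulr_sumr; apply: ler_sum => k _.
    exact: term.
  by rewrite mulrAC ler_pdivrMr// ler_wpM2l.
have lim0 : 0 <= limn (series (fun j => \sum_(k < N j) a j k)).
  apply: limr_ge => //; apply: nearW => m; apply: sumr_ge0 => j _; exact: sumr_ge0.
rewrite -[leRHS](powRr1 S0) -(@mulVf _ lam) ?lt0r_neq0// powRrM.
by rewrite ge0_ler_powR ?nnegrE ?(ltW l0).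
Qed.

(** * Membership in L^lambda *)

Section Llambda.
Variable lam : R.
Hypotheses (l0 : 0 < lam) (l1 : n%:R * lam < n.+2%:R).

Let ep2 : 0 < ep / 2. Proof. by rewrite divr_gt0. Qed.
Let y := q `^ (ep / 2).
Let y01 : 0 <= y < 1. Proof. exact: powR_q_lt1. Qed.
Let y1 : 0 < 1 - y. Proof. by have /andP[_] := y01; rewrite subr_gt0. Qed.
Let D := (1 - y)^-1 * (1 - y)^-1.
Let D0 : 0 < D. Proof. by rewrite mulr_gt0 ?invr_gt0. Qed.
Let ka := ep / 2 * lam.
Let ka0 : 0 < ka. Proof. by rewrite mulr_gt0. Qed.
(** Power of time left after integrating Phi^lambda over space; [l1] says exactly that it exceeds
    -1. *)
Let be := n%:R * (1 - lam) / 2.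
Let be1 : -1 < be. Proof. by move: l1; rewrite /be -addn2 natrD; lra. Qed.
Let start j k := peak j - 4 * scale j k ^+ 2.
Let C1 := D `^ lam * (lam `^ (- (n%:R / 2)) * (4 * pi) `^ be).
Let C10 : 0 <= C1. Proof. by rewrite !mulr_ge0 ?powR_ge0. Qed.

(** Age of the kernel once switched on. The default 1 keeps the Gaussian rate [bb] positive earlier,
    when the indicator in [cc] kills the term. *)
Let ta j k s := if start j k < s then s - start j k + scale j k ^+ 2 else 1.
Let ta0 j k s : 0 < ta j k s.
Proof.
rewrite /ta; case: ifP => // h; have := exprn_gt0 2 (scale_gt0 j k); lra.
Qed.

Let cc j k s := D `^ lam * scale j k `^ ka * \1_(`]start j k, +oo[%classic : set R) s
   * (4 * pi * ta j k s) `^ (- (n%:R / 2) * lam).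
Let bb j k s := lam / (4 * ta j k s).

Lemma sum_scale_half_le m : \sum_(0 <= j < m) \sum_(k < (K j).+1) scale j k `^ (ep / 2) <= D.
Proof.
apply: (@le_trans _ _ (\sum_(0 <= j < m) (1 - y)^-1 * y ^+ j)).
  by apply: ler_sum => j _; exact: sum_scale_powR_le.
rewrite -mulr_sumr big_mkord ler_wpM2l ?invr_ge0 ?(ltW y1)//.
exact: geometric_sum_le.
Qed.

Lemma tower_powR_le (x : 'rV[R]_n) s : 0 < s ->
  ((`|tower (x, s)| `^ lam)%:E <= \sum_(j <oo) \sum_(k < (K j).+1)
     (cc j k s * expR (- (bb j k s * sqnorm x)))%:E)%E.
Proof.
move=> s0; have Us : U0 (x, s) by [].
have tw0 : 0 <= tower (x, s).
  apply: (le_trans _ (tower_ge (j := 0%N) (k := 0%N) Us (leq0n _))).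
  by apply: mulr_ge0; [exact/ltW/mass_gt0|exact: heat_bump_ge0].
rewrite (ger0_norm tw0).
have a0 j k : 0 <= mass j k * heat_bump (peak j) (scale j k) (x, s).
  by apply: mulr_ge0; [exact/ltW/mass_gt0|exact: heat_bump_ge0].
have de0 j k : 0 < scale j k `^ (ep / 2) by rewrite powR_gt0 ?scale_gt0.
apply: le_trans (powR_series_le l0 D0 a0 de0 sum_scale_half_le (cvg_chain Us)) _.
apply: lee_nneseries => [j _ _|j _].
  by apply: sume_ge0 => k _; rewrite lee_fin mulr_ge0 ?powR_ge0.
apply: lee_sum => k _; rewrite lee_fin.
(* Half of the exponent [ep] pays for the weights of [powR_series_le]; the other half keeps the
   series of integrals summable. *)
have -> : mass j k * heat_bump (peak j) (scale j k) (x, s) / scale j k `^ (ep / 2)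
    = scale j k `^ (ep / 2) * heat_bump (peak j) (scale j k) (x, s).
  rewrite mulrAC; congr (_ * _); apply: (canLR (mulfK _)); first by rewrite lt0r_neq0.
  rewrite -powRD; last by apply/implyP => _; rewrite gt_eqF ?scale_gt0.
  by rewrite -splitr.
have -> : cc j k s * expR (- (bb j k s * sqnorm x)) = D `^ lam * (scale j k `^ ka *
   (\1_(`]start j k, +oo[%classic : set R) s * ((4 * pi * ta j k s) `^ (- (n%:R / 2) * lam)
     * expR (- (bb j k s * sqnorm x))))) by rewrite /cc !mulrA.
rewrite ler_wpM2l ?powR_ge0// /heat_bump /=.
have tE : s + (5 * scale j k ^+ 2 - peak j) = s - start j k + scale j k ^+ 2.
  by rewrite /start; ring.
have [hs|hs] := ltP (start j k) s; last first.
  rewrite -[X in _ * X]/(heat_bump (peak j) (scale j k) (x, s)).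
  rewrite heat_bump_eq0 ?scale_gt0// mulr0 powR0 ?lt0r_neq0//.
  by rewrite !mulr_ge0 ?powR_ge0 ?expR_ge0// indicE.
have t0 : 0 < s - start j k + scale j k ^+ 2.
  by have := exprn_gt0 2 (scale_gt0 j k); lra.
rewrite indicE mem_set ?mul1r; last by rewrite /= in_itv /= hs.
rewrite /bb /ta hs tE; set t := s - _ + _ in t0 *.
have st0 : 0 <= step ((s - peak j) / scale j k ^+ 2 + 4) * heat_kernel x t.
  by apply: mulr_ge0; [exact: step_ge0|exact: heat_kernel_ge0].
rewrite [leLHS]powRM ?powR_ge0// -powRrM -/ka.
rewrite ler_wpM2l ?powR_ge0//.
apply: (@le_trans _ _ (heat_kernel x t `^ lam)).
  rewrite ge0_ler_powR ?nnegrE ?(ltW l0) ?heat_kernel_ge0//.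
  by rewrite ler_piMl ?heat_kernel_ge0 ?step_le1.
rewrite /heat_kernel t0 [leLHS]powRM ?powR_ge0 ?expR_ge0// -powRrM.
rewrite -expRM.
have -> : - (sqnorm x / (4 * t)) * lam = - (lam / (4 * t) * sqnorm x).
  by field; rewrite lt0r_neq0.
exact: lexx.
Qed.

Lemma cc_sqrt j k s : cc j k s * Num.sqrt (pi / bb j k s) ^+ n =
  C1 * scale j k `^ ka * (\1_(`]start j k, +oo[%classic : set R) s
     * (s - start j k + scale j k ^+ 2) `^ be).
Proof.
rewrite /cc indicE; case: (boolP (s \in _)); last by rewrite !(mulr0, mul0r).
rewrite inE /= in_itv /= andbT => hs; rewrite /bb /ta hs !mulr1 !mul1r.
have t0 : 0 < s - start j k + scale j k ^+ 2.
  by have := exprn_gt0 2 (scale_gt0 j k); lra.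
set t := s - _ + _ in t0 *.
have pi0 := pi_gt0 R.
have -> : pi / (lam / (4 * t)) = lam^-1 * (4 * pi * t).
  by move: pi0; move: (pi : R) => w w0; field; rewrite !lt0r_neq0.
have p0 : 0 < 4 * pi * t by rewrite !mulr_gt0.
have z0 : 0 <= lam^-1 * (4 * pi * t) by rewrite mulr_ge0 ?invr_ge0 ?ltW.
have -> : Num.sqrt (lam^-1 * (4 * pi * t)) ^+ n = lam `^ (- (n%:R / 2)) * (4 * pi * t) `^ (n%:R / 2).
  rewrite -(powR12_sqrt z0) -powR_mulrn ?powR_ge0// -powRrM.
  rewrite (_ : 2^-1 * n%:R = n%:R / 2); last exact: mulrC.
  have li0 : 0 <= lam^-1 by rewrite invr_ge0 ltW.
  rewrite (powRM _ li0 (ltW p0)); congr (_ * _).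
  by rewrite -powR_inv1 ?(ltW l0)// -powRrM mulN1r.
have E : (4 * pi * t) `^ (- (n%:R / 2) * lam) * (4 * pi * t) `^ (n%:R / 2) = (4 * pi) `^ be * t `^ be.
  rewrite -powRM ?(ltW t0) ?mulr_ge0 ?(ltW pi0)//.
  rewrite -powRD; last by apply/implyP => _; rewrite gt_eqF.
  by congr (_ `^ _); rewrite /be; field.
move: E; rewrite /C1; set P1 := _ `^ (_ * lam); set P2 := _ `^ (n%:R / 2).
set Q1 := _ `^ be; set Q2 := t `^ be; set L := lam `^ _; set S := scale j k `^ ka => E.
transitivity (D `^ lam * S * L * (P1 * P2)); first by ring.
by rewrite E; ring.
Qed.

Lemma tower_Llambda :
  (integral_strip (fun y s => (`|tower (y, s)| `^ lam)%:E) < +oo)%E.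
Proof.
(* 6 is a crude bound for 1 - [start] + r^2 = 1 - T + 5 r^2, as r^2 <= T < 1. *)
pose B := 6 `^ (be + 1) / (be + 1).
have B0 : 0 <= B by rewrite divr_ge0 ?powR_ge0//; move: be1; lra.
pose yk := q `^ ka.
have yk01 : 0 <= yk < 1 by exact: powR_q_lt1.
have yk1 : 0 < 1 - yk by have /andP[_] := yk01; rewrite subr_gt0.
apply: (@le_lt_trans _ _ (C1 * B * ((1 - yk)^-1 * (1 - yk)^-1))%:E); last exact: ltry.
rewrite /integral_strip.
apply: (@le_trans _ _ (\int[@lebesgue_measure R]_(s in `]0%R, 1%R[%classic)
   (\sum_(j <oo) \sum_(k < (K j).+1) ((C1 * scale j k `^ ka)%:E * (\1_(`]start j k, +oo[%classic : set R) s
     * (s - start j k + scale j k ^+ 2) `^ be)%:E)))%E).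
  apply: le_integral_ge0 => s /=; rewrite in_itv /= => /andP[s0 s1].
    by apply: integral_Rn_ge0 => v; rewrite lee_fin powR_ge0.
  apply: (@le_trans _ _ (integral_Rn (fun v : 'rV[R]_n => \sum_(j <oo) \sum_(k < (K j).+1)
     (cc j k s * expR (- (bb j k s * sqnorm v)))%:E)%E)).
    apply: le_integral_Rn => v; first by rewrite lee_fin powR_ge0.
    exact: tower_powR_le.
  rewrite (@integral_Rn_gauss_series R n (fun j => (K j).+1) (fun j k => cc j k s) (fun j k => bb j k s)); last 2 first.
  - by move=> j k; rewrite /cc !mulr_ge0 ?powR_ge0// indicE.
  - by move=> j k; rewrite /bb divr_gt0// mulr_gt0.
  apply: lee_nneseries => [j _ _|j _].
    apply: sume_ge0 => k _; rewrite cc_sqrt lee_fin !mulr_ge0 ?powR_ge0// indicE//.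
  by apply: lee_sum => k _; rewrite cc_sqrt EFinM.
have i0 j k s : (0 <= (\1_(`]start j k, +oo[%classic : set R) s
     * (s - start j k + scale j k ^+ 2) `^ be)%:E)%E.
  by rewrite lee_fin mulr_ge0 ?powR_ge0// indicE.
have k0 j k : 0 <= C1 * scale j k `^ ka by rewrite mulr_ge0 ?powR_ge0.
have i0' j k s : (0 <= (C1 * scale j k `^ ka)%:E * (\1_(`]start j k, +oo[%classic : set R) s
     * (s - start j k + scale j k ^+ 2) `^ be)%:E)%E.
  by apply: mule_ge0; [rewrite lee_fin; exact: k0|exact: i0].
have mm j k : measurable_fun (`]0%R, 1%R[%classic : set R) (fun s : R => (\1_(`]start j k, +oo[%classic : set R) s
     * (s - start j k + scale j k ^+ 2) `^ be)).
  apply: measurable_funTS; apply: measurable_funM; first exact: measurable_indic.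
  apply: (measurableT_comp (measurable_powR be)).
  by apply: measurable_funD => //; apply: measurable_funD.
rewrite integral_nneseries//; last 2 first.
- move=> j; apply: emeasurable_sum => k; apply: emeasurable_funM => //.
  (apply/measurable_EFinP; exact: mm).
- by move=> j s _; apply: sume_ge0.
have key j : (\int[@lebesgue_measure R]_(s in `]0%R, 1%R[%classic)
   (\sum_(k < (K j).+1) ((C1 * scale j k `^ ka)%:E * (\1_(`]start j k, +oo[%classic : set R) s
     * (s - start j k + scale j k ^+ 2) `^ be)%:E)) <= (C1 * B * ((1 - yk)^-1 * yk ^+ j))%:E)%E.
  rewrite ge0_integral_sum//; last first.
    by move=> k; apply: emeasurable_funM => //; (apply/measurable_EFinP; exact: mm).
  apply: (@le_trans _ _ (\sum_(k < (K j).+1) (C1 * B * scale j k `^ ka)%:E)%E).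
    apply: lee_sum => k _; rewrite ge0_integralZl_EFin//; last (apply/measurable_EFinP; exact: mm).
    rewrite (_ : C1 * B * scale j k `^ ka = C1 * scale j k `^ ka * B); last exact: mulrAC.
    rewrite (EFinM (C1 * scale j k `^ ka)) lee_wpmul2l ?lee_fin//.
    apply: integral_shifted_powR => //; first by rewrite exprn_gt0 ?scale_gt0.
    have := scale2_le_peak j k; have := peak_lt1 j; have := exprn_gt0 2 (scale_gt0 j k).
    by rewrite /start; lra.
  rewrite sumEFin lee_fin (_ : \sum_(k < (K j).+1) C1 * B * scale j k `^ ka
    = C1 * B * \sum_(k < (K j).+1) scale j k `^ ka); last by rewrite mulr_sumr.
  rewrite ler_wpM2l//; last exact: sum_scale_powR_le.
  exact: mulr_ge0.
apply: (@le_trans _ _ (\sum_(j <oo) (C1 * B * ((1 - yk)^-1 * yk ^+ j))%:E)%E).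
  apply: lee_nneseries => [j _ _|j _ //].
  by apply: integral_ge0 => s _; apply: sume_ge0.
have p0 j : 0 <= C1 * B * ((1 - yk)^-1 * yk ^+ j).
  have /andP[yk0 _] := yk01; apply: mulr_ge0; first exact: mulr_ge0.
  by apply: mulr_ge0; [rewrite invr_ge0 ltW|exact: exprn_ge0].
apply: lime_le; first by apply: is_cvg_nneseries => j _ _; rewrite lee_fin.
apply: nearW => m; rewrite sumEFin lee_fin.
rewrite (_ : \sum_(0 <= j < m) C1 * B * ((1 - yk)^-1 * yk ^+ j)
    = C1 * B * \sum_(0 <= j < m) (1 - yk)^-1 * yk ^+ j); last by rewrite mulr_sumr.
rewrite ler_wpM2l//; first exact: mulr_ge0.
rewrite -mulr_sumr big_mkord ler_wpM2l ?invr_ge0 ?(ltW yk1)//.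
exact: geometric_sum_le.
Qed.

End Llambda.

Lemma lim_series_single (x : nat -> R) j : (forall i, i != j -> x i = 0) ->
  limn (series x) = x j.
Proof.
move=> xi; apply: cvg_lim => //; apply: cvg_near_cst; near=> m.
have jm : (j < m)%N by near: m; exact: nbhs_infty_gt.
rewrite /series /= (bigD1_seq j)//= ?mem_index_iota ?iota_uniq//.
by rewrite big1 ?addr0.
Unshelve. all: by end_near. Qed.

(** * The differential inequality *)

Section source.
Let z j k (p : V) := (p.2 - peak j) / scale j k ^+ 2 + 4.

Let src j k (p : V) := mass j k * (step' (z j k p) / scale j k ^+ 2 *
  heat_kernel p.1 (p.2 + (5 * scale j k ^+ 2 - peak j))).

Let sc2 j k : 0 < scale j k ^+ 2. Proof. by rewrite exprn_gt0// scale_gt0. Qed.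

Lemma src_ge0 j k p : 0 <= src j k p.
Proof.
apply: mulr_ge0; first exact/ltW/mass_gt0.
apply: mulr_ge0; last exact: heat_kernel_ge0.
by apply: divr_ge0; [exact: step'_ge0|exact: ltW].
Qed.

Lemma activeP j k p : 0 < z j k p < 1 ->
  peak j - 4 * scale j k ^+ 2 < p.2 < peak j - 3 * scale j k ^+ 2.
Proof.
have E : p.2 - peak j = (z j k p - 4) * scale j k ^+ 2.
  by rewrite /z addrK divfK// lt0r_neq0.
move=> /andP[z0 z1]; have s2 := sc2 j k.
have h1 : 0 < z j k p * scale j k ^+ 2 by rewrite mulr_gt0.
have h2 : z j k p * scale j k ^+ 2 < scale j k ^+ 2 by rewrite gtr_pMl.
by rewrite mulrBl in E; apply/andP; split; lra.
Qed.

(** The window of k = 0 ends at T - 3T < 0. Hence any term being switched on at a positive time has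
    a predecessor to support it. *)
Lemma active_gt0 j k p : U0 p -> 0 < z j k p < 1 -> (0 < k)%N.
Proof.
move=> Up /activeP/andP[_]; case: k => // h.
by have Up' : 0 < p.2 := Up; move: h; rewrite -/(peak j); have := peak_gt0 j; lra.
Qed.

Lemma scale2_lt j k k' : (k < k')%N -> scale j k' ^+ 2 <= scale j k ^+ 2 / 16.
Proof.
move=> kk; apply: le_trans (scale2S j k).
by apply: lerXn2r; rewrite ?nnegrE ?(ltW (scale_gt0 _ _))// scale_le.
Qed.

Lemma active_peak j k p : U0 p -> 0 < z j k p < 1 -> 3 / 4 * peak j < p.2 < peak j.
Proof.
move=> Up a; have k0 := active_gt0 Up a; have /andP[h1 h2] := activeP a.
have := scale2_lt j k0; rewrite -/(peak j); have := sc2 j k; lra.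
Qed.

(** Chain j is active only in (3T/4, T) with T = [peak j], and the next apex is below T/16; within a
    chain the windows are separated by [scale2_lt]. *)
Lemma active_unique j k j' k' p : U0 p -> 0 < z j k p < 1 -> 0 < z j' k' p < 1 ->
  j = j' /\ k = k'.
Proof.
move=> Up a a'.
have lt_jj i l i' l' : (i < i')%N -> 0 < z i l p < 1 -> 0 < z i' l' p < 1 -> False.
  move=> ii b b'; have /andP[h1 _] := active_peak Up b; have /andP[_ h2] := active_peak Up b'.
  have := peak_le ii; have := peakS i; have := peak_gt0 i; lra.
have [jj|jj|jj] := ltngtP j j'; [by case: (lt_jj _ _ _ _ jj a a')|by case: (lt_jj _ _ _ _ jj a' a)|].
split=> //; subst j'.
have lt_kk l l' : (l < l')%N -> 0 < z j l p < 1 -> 0 < z j l' p < 1 -> False.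
  move=> ll /activeP/andP[_ h2] /activeP/andP[h1 _].
  have := scale2_lt j ll; have := sc2 j l'; have := sc2 j l; lra.
by have [kk|kk|//] := ltngtP k k'; [case: (lt_kk _ _ kk a a')|case: (lt_kk _ _ kk a' a)].
Qed.

Lemma heat_op_chain_src j p : heat_op (chain j) p = \sum_(k < (K j).+1) src j k p.
Proof.
rewrite heat_op_chain; apply: eq_bigr => k _; rewrite heat_op_bump//.
exact: scale_gt0.
Qed.

Lemma src_inactive j k p : ~~ (0 < z j k p < 1) -> src j k p = 0.
Proof. by move=> a; rewrite /src step'_eq0// !mul0r mulr0. Qed.

Lemma heat_op_towerP p : U0 p ->
  heat_op tower p = 0 \/
  exists j k, [/\ (k.+1 <= K j)%N, 0 < z j k.+1 p < 1 & heat_op tower p = src j k.+1 p].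
Proof.
move=> Up; have [_ ->] := heat_op_tower Up.
have -> : (fun j => heat_op (chain j) p) = (fun j => \sum_(k < (K j).+1) src j k p).
  by apply/funext => j; rewrite heat_op_chain_src.
have [[j [k [kK a]]]|na] := pselect (exists j k, (k <= K j)%N /\ 0 < z j k p < 1).
  right; have := active_gt0 Up a; case: k kK a => // k kK a _; exists j, k; split=> //.
  rewrite (@lim_series_single _ j).
    rewrite (bigD1 (Ordinal (kK : (k.+1 < (K j).+1)%N)))//= big1 ?addr0// => l lk.
    apply: src_inactive; apply/negP => b; have [_ E] := active_unique Up a b.
    by move/eqP: lk; apply; apply: val_inj.
  move=> i ij; rewrite big1// => l _; apply: src_inactive; apply/negP => b.
  by have [E _] := active_unique Up a b; rewrite E eqxx in ij.
(* All terms vanish, so the index 0 is arbitrary. *)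
left; rewrite (@lim_series_single _ 0).
  rewrite big1// => l _; apply: src_inactive; apply/negP => b; apply: na.
  by exists 0%N, l; split => //; rewrite -ltnS.
move=> i _; rewrite big1// => l _; apply: src_inactive; apply/negP => b; apply: na.
by exists i, l; split => //; rewrite -ltnS.
Qed.

Lemma heat_op_tower_ge0 p : U0 p -> 0 <= heat_op tower p.
Proof.
by move=> Up; have [->//|[j [k [_ _ ->]]]] := heat_op_towerP Up; exact: src_ge0.
Qed.

(** Worst case taken separately: the largest time in the prefactor, the smallest in the Gaussian.
    The upper bound below exchanges the two. *)
Lemma heat_kernel_expR_ge (x : 'rV[R]_n) (a A t : R) : 0 < a -> a <= t <= A ->
  expR (- (n%:R / 2) * ln (4 * pi * A) - sqnorm x * (4 * a)^-1) <= heat_kernel x t.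
Proof.
move=> a0 /andP[at_ tA]; have t0 := lt_le_trans a0 at_; have A0 := lt_le_trans t0 tA.
rewrite heat_kernelE// ler_expR lerB//.
  rewrite !mulNr lerN2 ler_wpM2l ?divr_ge0// ler_ln ?posrE ?mulr_gt0 ?pi_gt0//.
  by rewrite ler_pM2l// mulr_gt0 ?pi_gt0.
rewrite ler_wpM2l//; first by apply: sumr_ge0 => i _; exact: sqr_ge0.
by rewrite lef_pV2 ?posrE ?mulr_gt0// ler_pM2l.
Qed.

Lemma heat_kernel_expR_le (x : 'rV[R]_n) (a A t : R) : 0 < a -> a <= t <= A ->
  heat_kernel x t <= expR (- (n%:R / 2) * ln (4 * pi * a) - sqnorm x * (4 * A)^-1).
Proof.
move=> a0 /andP[at_ tA]; have t0 := lt_le_trans a0 at_; have A0 := lt_le_trans t0 tA.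
rewrite heat_kernelE// ler_expR lerB//.
  rewrite !mulNr lerN2 ler_wpM2l ?divr_ge0// ler_ln ?posrE ?mulr_gt0 ?pi_gt0//.
  by rewrite ler_pM2l// mulr_gt0 ?pi_gt0.
rewrite ler_wpM2l//; first by apply: sumr_ge0 => i _; exact: sqr_ge0.
by rewrite lef_pV2 ?posrE ?mulr_gt0// ler_pM2l.
Qed.

Lemma ln_scaled (c r : R) : 0 < c -> 0 < r -> ln (4 * pi * (c * r ^+ 2)) = ln (4 * pi * c) + 2 * ln r.
Proof.
move=> c0 r0'; rewrite mulrA lnM ?posrE ?mulr_gt0 ?pi_gt0 ?exprn_gt0//.
by rewrite lnXn//; congr (_ + _); rewrite mulr_natl.
Qed.

Let nu := n%:R - ep.
(** Logarithm of the constant in P^(-nu) (4 pi 5)^(-n/2), the amplitude of the parent, once its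
    radius P = r/q is expressed through r. *)
Let lka := nu * ln q - n%:R / 2 * ln (4 * pi * 5).

(** The time range covers both the window of the child and the box used for the convolution. There
    the parent is fully on and its kernel has age between 4 P^2 and 5 P^2, since r^2 <= P^2/16. *)
Lemma parent_ge j k (x : 'rV[R]_n) (t : R) : (k.+1 <= K j)%N ->
  peak j - 6 * scale j k.+1 ^+ 2 <= t <= peak j - 3 * scale j k.+1 ^+ 2 ->
  0 < t /\
  expR (lka - nu * ln (scale j k.+1) - q ^+ 2 / 16 * (sqnorm x / scale j k.+1 ^+ 2))
    <= tower (x, t).
Proof.
move=> kK /andP[t1 t2].
have P0 := scale_gt0 j k; have P2 := sc2 j k; have r2 := sc2 j k.+1.
have rP := scale2S j k; have PT := scale2_le_peak j k.
set P := scale j k in P0 P2 rP PT *.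
have t0 : 0 < t by lra.
split=> //; apply: (le_trans _ (tower_ge (p := (x, t)) t0 (ltnW kK))).
rewrite /heat_bump /= step_ge1 ?mul1r; last first.
  by rewrite -lerBlDr ler_pdivlMr// -/P; lra.
have tb : 4 * P ^+ 2 <= t + (5 * P ^+ 2 - peak j) <= 5 * P ^+ 2.
  by apply/andP; split; lra.
have P4 : 0 < 4 * P ^+ 2 by rewrite mulr_gt0.
apply: (@le_trans _ _ (mass j k * expR (- (n%:R / 2) * ln (4 * pi * (5 * P ^+ 2)) - sqnorm x * (4 * (4 * P ^+ 2))^-1))); last first.
  by rewrite ler_wpM2l ?(ltW (mass_gt0 _ _))//; exact: heat_kernel_expR_ge.
rewrite /mass -/P /powR gt_eqF// -expRD ler_expR ln_scaled//.
have -> : ln (scale j k.+1) = ln q + ln P by rewrite scaleS lnM// posrE.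
have -> : q ^+ 2 / 16 * (sqnorm x / scale j k.+1 ^+ 2) = sqnorm x * (4 * (4 * P ^+ 2))^-1.
  by rewrite scaleS -/P; field; rewrite !lt0r_neq0.
rewrite /lka /nu.
by set L := ln P; set lq := ln q; set l5 := ln _; lra.
Qed.

Variables (al lam sig : R).
Hypotheses (n0 : (0 < n)%N) (al0 : 0 < al) (l0 : 0 < lam) (s0 : 0 < sig).
Hypothesis q2 : q ^+ 2 * (lam + sig) <= 1.
Let E := ep - 4 - 2 * n%:R + al + nu * (lam + sig).
Hypothesis E0 : 0 < E.
(** Logarithm of the final inequality at r = r0 and x = 0: constants of the source on the left, of
    the lower bounds for kernel and parent on the right. *)
Hypothesis r0E : E * ln r0 + (ln 8 + 4) - n%:R / 2 * ln (4 * pi * 1) <=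
  - (al / 2) * ln (4 * pi * 3) - al / 4 + (lam + sig) * lka - lam * n%:R * q ^+ 2 / 8.

Let nN0 : (n%:R : R) != 0. Proof. by rewrite pnatr_eq0 -lt0n. Qed.

Lemma src_le j k p : 0 < z j k p < 1 ->
  src j k p <= expR ((ep - 2 - n%:R) * ln (scale j k) + (ln 8 + 4)
     - n%:R / 2 * ln (4 * pi * 1) - sqnorm p.1 / scale j k ^+ 2 / 8).
Proof.
move=> a; have /andP[h1 h2] := activeP a; have r2 := sc2 j k; have rr := scale_gt0 j k.
rewrite /src; set r := scale j k in r2 rr h1 h2 *.
have tb : 1 * r ^+ 2 <= p.2 + (5 * r ^+ 2 - peak j) <= 2 * r ^+ 2 by apply/andP; split; lra.
have r1 : 0 < 1 * r ^+ 2 by rewrite mul1r.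
have hk := heat_kernel_expR_le p.1 r1 tb.
apply: (@le_trans _ _ (expR (ep * ln r) * (expR (ln 8 + 4) * expR (- (2 * ln r)) * expR (- (n%:R / 2) * ln (4 * pi * (1 * r ^+ 2)) - sqnorm p.1 * (4 * (2 * r ^+ 2))^-1)))).
  rewrite /mass /powR gt_eqF// ler_wpM2l ?expR_ge0//.
  apply: ler_pM => //; [|exact: heat_kernel_ge0|].
    by apply: divr_ge0; [exact: step'_ge0|exact: ltW].
  have -> : expR (- (2 * ln r)) = r ^- 2 by rewrite expRN expRM_natl lnK.
  rewrite ler_wpM2r ?invr_ge0 ?(ltW r2)// expRD lnK ?posrE//.
  exact: step'_bound.
rewrite -!expRD ler_expR ln_scaled//.
have -> : sqnorm p.1 * (4 * (2 * r ^+ 2))^-1 = sqnorm p.1 / r ^+ 2 / 8.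
  by field; rewrite lt0r_neq0.
by set L := ln r; set l5 := ln (4 * pi * 1); lra.
Qed.

Lemma sqnorm_box (x y : 'rV[R]_n) r : (forall i, x 0 i <= y 0 i <= x 0 i + r) ->
  sqnorm (x - y) <= n%:R * r ^+ 2 /\ sqnorm y <= 2 * sqnorm x + 2 * (n%:R * r ^+ 2).
Proof.
move=> xy.
have d i : ((x - y) 0 i) ^+ 2 <= r ^+ 2.
  have /andP[h1 h2] := xy i; rewrite !mxE -sqrrN opprB.
  by apply: lerXn2r; rewrite ?nnegrE; lra.
have s : sqnorm (x - y) <= n%:R * r ^+ 2.
  apply: (@le_trans _ _ (\sum_(i < n) r ^+ 2)); first by apply: ler_sum => i _; exact: d.
  by rewrite sumr_const card_ord mulr_natl.
split=> //; apply: (@le_trans _ _ (2 * sqnorm x + 2 * sqnorm (x - y))); last by lra.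
rewrite /sqnorm !mulr_sumr -big_split /=; apply: ler_sum => i _; rewrite !mxE.
(* 2x^2 + 2(x-y)^2 - y^2 = (2x-y)^2. *)
by have := sqr_ge0 (2 * x 0 i - y 0 i); rewrite !expr2; lra.
Qed.

(** Comparison with a constant on one parabolic box; measurability of [f] does not enter. *)
Lemma integral_strip_ge (f : 'rV[R]_n -> R -> R) (x : 'rV[R]_n) (s1 r B : R) :
  (forall y s, 0 <= f y s) -> 0 < r -> 0 <= B ->
  0 < s1 -> s1 + r ^+ 2 < 1 ->
  (forall (y : 'rV[R]_n) s, (forall i, x 0 i <= y 0 i <= x 0 i + r) -> s1 <= s <= s1 + r ^+ 2 -> B <= f y s) ->
  ((B * r ^+ n * r ^+ 2)%:E <= integral_strip (fun y s => (f y s)%:E))%E.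
Proof.
move=> f0 rp B0 s1p s11 fB; have r2 : 0 < r ^+ 2 by rewrite exprn_gt0.
rewrite /integral_strip.
apply: (@le_trans _ _ (\int[@lebesgue_measure R]_(s in `[s1, (s1 + r ^+ 2)%R]%classic) (cst (B * r ^+ n)%:E s))%E).
  rewrite integral_cst//= lebesgue_measure_itv/= lte_fin ltrDl r2.
  by rewrite -EFinB addrAC subrr add0r -EFinM.
apply: le_integral_restrict => s; rewrite /patch.
case: ifPn => [|_]; last first.
  by case: ifPn => _; rewrite lexx//= integral_Rn_ge0// => v; rewrite lee_fin.
rewrite inE /= in_itv /= => /andP[h1 h2].
rewrite lee_fin mulr_ge0 ?exprn_ge0 ?(ltW rp)//=.
rewrite ifT; last by rewrite inE /= in_itv /=; apply/andP; split; lra.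
rewrite -(integral_Rn_box (fun i => x 0 i) rp B0).
apply: le_integral_Rn => v.
  by rewrite lee_fin mulr_ge0// prodr_ge0// => i _; rewrite indicE.
rewrite lee_fin; have [vx|] := pselect (forall i, x 0 i <= v 0 i <= x 0 i + r).
  rewrite big1 ?mulr1; first by apply: fB => //; rewrite h1.
  by move=> i _; rewrite indicE mem_set// /= in_itv /= vx.
move=> /existsNP[i ni]; rewrite (bigD1 i)//= indicE memNset ?mul0r ?mulr0//.
Qed.

Lemma tower_source p : U0 p -> p.2 < 1 ->
  ((heat_op tower p)%:E <=
     integral_strip (fun y s =>
       ((heat_kernel (p.1 - y) (p.2 - s)) `^ (al / n%:R) * tower (y, s) `^ lam)%:E)
     * (tower p `^ sig)%:E)%E.
Proof.
move=> Up p1; have [->|[j [k [kK a ->]]]] := heat_op_towerP Up.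
  rewrite mule_ge0 ?lee_fin ?powR_ge0//; apply: integral_ge0 => s _.
  by apply: integral_Rn_ge0 => v; rewrite lee_fin mulr_ge0 ?powR_ge0.
have /andP[h1 h2] := activeP a; have r2 := sc2 j k.+1; have rr := scale_gt0 j k.+1.
have rT : scale j k.+1 ^+ 2 <= peak j / 16.
  by have := scale2_lt j (ltn0Sn k).
have T1 := peak_lt1 j; have T0 := peak_gt0 j.
have sl := src_le a.
have Hp := @parent_ge j k p.1 p.2 kK; set r := scale j k.+1 in h1 h2 r2 rr rT sl Hp *.
have [_ up] : 0 < p.2 /\ expR (lka - nu * ln r - q ^+ 2 / 16 * (sqnorm p.1 / r ^+ 2)) <= tower (p.1, p.2).
  by apply: Hp; apply/andP; split; lra.
have {}up : expR (lka - nu * ln r - q ^+ 2 / 16 * (sqnorm p.1 / r ^+ 2)) <= tower p by case: p up {Up p1 a h1 h2 sl Hp}.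
set X := sqnorm p.1 / r ^+ 2 in up sl.
(* Minimum over the box: the kernel has age between r^2 and 3 r^2 at distance at most sqrt(n) r, and
   the parent is taken at |y|^2 <= 2|x|^2 + 2n r^2. *)
pose B := expR ((al / n%:R) * (- (n%:R / 2) * (ln (4 * pi * 3) + 2 * ln r) - n%:R / 4)
   + lam * (lka - nu * ln r - q ^+ 2 / 16 * (2 * X + 2 * n%:R))).
have I_ge : ((B * r ^+ n * r ^+ 2)%:E <= integral_strip (fun y s =>
       ((heat_kernel (p.1 - y) (p.2 - s)) `^ (al / n%:R) * tower (y, s) `^ lam)%:E))%E.
  apply: (@integral_strip_ge (fun y s => (heat_kernel (p.1 - y) (p.2 - s)) `^ (al / n%:R) * tower (y, s) `^ lam) p.1 (peak j - 6 * r ^+ 2)).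
  - by move=> y s; rewrite mulr_ge0 ?powR_ge0.
  - exact: rr.
  - exact: expR_ge0.
  - by lra.
  - by lra.
  move=> y s xy /andP[s1 s2]; have [d1 d2] := sqnorm_box xy.
  have [_ uy] := @parent_ge j k y s kK ltac:(by rewrite -/r; apply/andP; split; lra).
  rewrite -/r in uy.
  have tb : 1 * r ^+ 2 <= p.2 - s <= 3 * r ^+ 2 by apply/andP; split; lra.
  have r1 : 0 < 1 * r ^+ 2 by rewrite mul1r.
  have hk := heat_kernel_expR_ge (p.1 - y) r1 tb.
  rewrite /B expRD; apply: ler_pM; rewrite ?expR_ge0//.
    rewrite mulrC expRM ge0_ler_powR ?nnegrE ?expR_ge0 ?heat_kernel_ge0 ?divr_ge0 ?(ltW al0)//.
    apply: le_trans hk; rewrite ler_expR ln_scaled// lerD2l lerN2 mul1r.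
    have r4 : 0 < 4 * r ^+ 2 by lra.
    by rewrite (ler_pdivrMr _ _ r4); lra.
  have tw0 : 0 <= tower (y, s) by exact: le_trans (expR_ge0 _) uy.
  rewrite mulrC expRM ge0_ler_powR ?nnegrE ?expR_ge0 ?(ltW l0)//.
  apply: le_trans uy; rewrite ler_expR lerD2l lerN2 ler_wpM2l//.
    by rewrite divr_ge0// exprn_ge0// ltW.
  rewrite ler_pdivrMr// mulrDl; apply: le_trans d2 _.
  by rewrite /X -!mulrA mulVf ?lt0r_neq0// mulr1.
apply: (@le_trans _ _ ((B * r ^+ n * r ^+ 2)%:E * (tower p `^ sig)%:E)%E); last first.
  by rewrite lee_wpmul2r// lee_fin powR_ge0.
rewrite -EFinM lee_fin; apply: le_trans sl _.
have us : expR ((lka - nu * ln r - q ^+ 2 / 16 * X) * sig) <= tower p `^ sig.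
  rewrite expRM ge0_ler_powR ?nnegrE ?expR_ge0 ?(ltW s0)//.
  exact: le_trans (expR_ge0 _) up.
apply: (@le_trans _ _ (B * r ^+ n * r ^+ 2 * expR ((lka - nu * ln r - q ^+ 2 / 16 * X) * sig))); last first.
  by rewrite ler_wpM2l// !mulr_ge0 ?expR_ge0// ?exprn_ge0// ltW.
have rE m : r ^+ m = expR (m%:R * ln r) by rewrite expRM_natl lnK.
rewrite [r ^+ n]rE [r ^+ 2]rE /B -!expRD ler_expR.
have lr : ln r <= ln r0.
  rewrite ler_ln ?posrE// /r /scale ler_piMr ?(ltW r00)// exprn_ile1 ?ltW//.
(* The coefficients of [ln r] add up to [E], so r <= r0 carries [r0E] over to r. *)
have El : E * ln r <= E * ln r0 by rewrite ler_pM2l.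
have X0 : 0 <= X.
  by apply: divr_ge0; [apply: sumr_ge0 => i _; exact: sqr_ge0|exact: ltW].
(* Gaussian part: the lower bounds lose (lam/8 + sig/16) q^2 X, the source decays like X/8. *)
have Xq : q ^+ 2 * (lam + sig) * X <= X by exact: ler_piMl.
have q20 : 0 <= q ^+ 2 by apply: exprn_ge0; exact: ltW.
have sX : 0 <= q ^+ 2 * sig * X by apply: mulr_ge0 => //; apply: mulr_ge0 => //; exact: ltW.
have -> : al / n%:R * (- (n%:R / 2) * (ln (4 * pi * 3) + 2 * ln r) - n%:R / 4) =
   - (al / 2) * ln (4 * pi * 3) - al * ln r - al / 4.
  by set l3 := ln (4 * pi * 3); set L := ln r; field.
move: El r0E; rewrite /E; set l3 := ln (4 * pi * 3); set l1 := ln (4 * pi * 1).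
set L := ln r; set L0 := ln r0; set l8 := ln 8.
move: Xq sX; set Q := q ^+ 2; move=> Xq sX El r0E'.
by lra.
Qed.

End source.

(** * Height at the apexes and choice of the parameters *)

Lemma tower_peak j :
  expR (- (n%:R - ep) * ln (scale j (K j)) - n%:R / 2 * ln (4 * pi * 5)) <=
  tower (0, peak j).
Proof.
have r2 : 0 < scale j (K j) ^+ 2 by rewrite exprn_gt0// scale_gt0.
have Up : U0 (0, peak j) by exact: peak_gt0.
apply: (le_trans _ (tower_ge (j := j) Up (leqnn (K j)))).
rewrite /heat_bump /= subrr mul0r add0r step_ge1 ?ler1n// mul1r (addrC (peak j)) subrK.
have h5 : 0 < 5 * scale j (K j) ^+ 2 by rewrite pmulr_rgt0.
rewrite (heat_kernelE _ h5) /mass /powR (gt_eqF (scale_gt0 _ _)) -expRD ler_expR.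
rewrite ln_scaled ?scale_gt0//.
have -> : sqnorm (0 : 'rV[R]_n) = 0 by apply: big1 => i _; rewrite mxE expr0n.
by set L := ln (scale _ _); set l5 := ln _; lra.
Qed.

End construction.

(** The exponent grows linearly in k with slope -nu ln q > 0, and 1 + x <= exp x turns this into a
    bound for any [M]. *)
Lemma exists_scale_index (R : realType) (q r0 nu c M : R) j :
  0 < q < 1 -> 0 < r0 < 1 -> 0 < nu ->
  exists k : nat, M <= expR (- nu * ln (scale q r0 j k) - c).
Proof.
move=> /andP[q0 q1] /andP[r00 r01] nu0.
have lq : ln q < 0 by rewrite ln_lt0// q0.
have lr : ln r0 < 0 by rewrite ln_lt0// r00.
have a0 : 0 < - nu * ln q by rewrite mulNr -mulrN mulr_gt0// oppr_gt0.
pose k := (Num.trunc (`|M + c| / (- nu * ln q))).+1.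
exists k; apply: (le_trans _ (expR_ge1Dx _)).
have kM : `|M + c| <= (- nu * ln q) * k%:R.
  by rewrite -ler_pdivrMl// mulrC ltW// truncnS_gt.
have -> : ln (scale q r0 j k) = ln r0 + (j%:R + k%:R) * ln q.
  by rewrite /scale lnM ?posrE ?exprn_gt0// lnXn// -natrD mulr_natl.
have h1 : 0 <= - nu * ln r0 by rewrite mulNr -mulrN mulr_ge0 ?oppr_ge0 ?(ltW lr) ?(ltW nu0).
have h2 : 0 <= - nu * ln q * j%:R by rewrite mulr_ge0// ltW.
have h3 := ler_norm (M + c).
by nra.
Qed.

Theorem theorem3p2 (R : realType) (n : nat) (alpha lambda sigma : R)
    (phi : R -> R) :
  (1 <= n)%N ->
  0 < alpha < n.+2%:R ->
  0 < lambda < n.+2%:R / n%:R ->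
  (2 * n.+2%:R - alpha) / n%:R - lambda < sigma ->
  (forall t : R, 0 < t < 1 -> 0 < phi t) ->
  {within `]0%R, 1%R[, continuous phi} ->
  phi t @[t --> 0^'+] --> +oo ->
  exists u : 'rV[R]_n * R -> R,
    [/\ (forall p, @strip R n p -> 0 < u p),
        smooth_on (@strip R n) u,
        (integral_strip (fun y s => (`|u (y, s)| `^ lambda)%:E) < +oo)%E,
        (forall p, @strip R n p ->
           0 <= heat_op u p /\
           ((heat_op u p)%:E <=
              integral_strip (fun y s =>
                ((heat_kernel (p.1 - y) (p.2 - s)) `^ (alpha / n%:R)
                  * u (y, s) `^ lambda)%:E)
              * (u p `^ sigma)%:E)%E)
      & ~ ((fun t => u (0, t)) =O_ (0^'+) phi)].
Proof.
move=> n1 /andP[al0 al1] /andP[l0 l1] sg phi0 _ _.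
have nR : 0 < n%:R :> R by rewrite ltr0n.
have l1' : n%:R * lambda < n.+2%:R by rewrite mulrC -ltr_pdivlMr.
have sg' : 2 * n.+2%:R - alpha < n%:R * (lambda + sigma).
  by move: sg; rewrite ltrBlDl ltr_pdivrMr// [_ * n%:R]mulrC.
(* n sigma > 2(n+2) - alpha - n lambda > 0, as alpha and n lambda are both below n+2. *)
have s0 : 0 < sigma by rewrite -(pmulr_rgt0 _ nR); lra.
pose L := lambda + sigma; have L0 : 0 < L by rewrite addr_gt0.
pose E0 := n%:R * L - (2 * n.+2%:R - alpha).
have E00 : 0 < E0 by rewrite subr_gt0.
(* Spends half of the slack [E0] of the hypothesis on sigma: the exponent becomes E = ep + E0/2. *)
pose ep := E0 / (2 * L).
have ep0 : 0 < ep by rewrite divr_gt0// mulr_gt0.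
have epL : ep * L = E0 / 2 by rewrite /ep; field; rewrite lt0r_neq0.
have nu0 : 0 < n%:R - ep.
  have nL : 0 < n%:R * L by rewrite mulr_gt0.
  by rewrite -(pmulr_rgt0 _ L0) mulrBr [L * ep]mulrC epL /E0; lra.
pose E := ep - 4 - 2 * n%:R + alpha + (n%:R - ep) * L.
have n2 : n.+2%:R = n%:R + 2 :> R by rewrite -addn2 natrD.
have EE : 0 < E by move: epL E00; rewrite /E /E0 n2; lra.
(* Gives both q <= 1/4 (disjoint windows) and q^2 L <= 1 (wide enough Gaussian of the parent). *)
pose q := (4 + L)^-1.
have q0 : 0 < q by rewrite invr_gt0; lra.
have q4 : q <= 4^-1 by rewrite lef_pV2 ?posrE; lra.
have q1 : q < 1 by lra.
have q2 : q ^+ 2 * L <= 1.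
  have qL : q * L <= 1 by rewrite /q mulrC ler_pdivrMr; lra.
  have qL0 : 0 <= q * L by rewrite mulr_ge0 ?ltW.
  by rewrite expr2 -mulrA; nra.
pose c : R := (ln 8 + 4) - n%:R / 2 * ln (4 * pi * 1).
pose d : R := - (alpha / 2) * ln (4 * pi * 3) - alpha / 4 + L *
  ((n%:R - ep) * ln q - n%:R / 2 * ln (4 * pi * 5)) - lambda * n%:R * q ^+ 2 / 8.
(* Then E ln r0 = -E - |c - d| <= d - c, which is the smallness required of the first radius; the 1
   ensures r0 < 1. *)
pose r0 := expR (- (1 + `|c - d| / E)).
have r00 : 0 < r0 by exact: expR_gt0.
have r01 : r0 < 1.
  by rewrite -[ltRHS]expR0 ltr_expR oppr_lt0 ltr_pwDl// divr_ge0// ltW.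
have r0E : E * ln r0 + (ln 8 + 4) - n%:R / 2 * ln (4 * pi * 1) <= d.
  rewrite /r0 expRK -addrA -/c mulrN mulrDr mulr1 mulrCA divff ?lt0r_neq0// mulr1.
  by have := ler_norm (c - d); lra.
(* The factor j + 1, not just [phi], is beaten, so no constant can work along the apexes. *)
have /boolp.choice[K HK] : forall j : nat, exists k : nat, j.+1%:R * phi (peak q r0 j) <=
    expR (- (n%:R - ep) * ln (scale q r0 j k) - n%:R / 2 * ln (4 * pi * 5)).
  by move=> j; apply: exists_scale_index => //; apply/andP.
exists (tower q r0 ep K).
have U0 p : @strip R n p -> [set p0 : 'rV[R]_n * R | 0 < p0.2] p by move=> /andP[].
split.
- move=> p /[dup] /U0 Up /andP[p0 p1].
  (* The background term of chain 0 has T = r^2, so at positive times its step argument exceeds 3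
     and it is a genuine kernel. *)
  apply: (lt_le_trans _ (tower_ge q0 q4 r00 r01 ep0 (j := 0) (k := 0) Up (leq0n _))).
  have rr := scale_gt0 q0 r00 0 0.
  have r2 : 0 < scale q r0 0 0 ^+ 2 by rewrite exprn_gt0.
  rewrite mulr_gt0 ?(mass_gt0 _ q0 r00)// /heat_bump /peak step_ge1; last first.
    by rewrite mulrBl divff ?lt0r_neq0//; have := divr_gt0 p0 r2; lra.
  rewrite mul1r heat_kernelE ?expR_gt0//; lra.
- apply: smooth_onP.
    rewrite (_ : @strip R n = [set p | 0 < p.2] `&` [set p | p.2 < 1]).
      by apply: openI; [exact: open_snd_gt|exact: open_snd_lt].
    by apply/seteqP; split => p /=; [move=> /andP|move=> [? ?]; apply/andP].
  by move=> k; apply: Ck_sub (Ck_tower K q0 q4 r00 r01 ep0 k).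
- exact: tower_Llambda.
- move=> p /[dup] /U0 Up /andP[p0 p1]; split; first exact: heat_op_tower_ge0.
  exact: (tower_source K q0 q4 r00 r01 ep0 n1 al0 l0 s0 q2 EE r0E).
- move=> /eqOP [C [_ HC]].
  have /HC : C < `|C| + 1 by rewrite (le_lt_trans (ler_norm _))// ltrDl.
  rewrite /at_right near_withinE => /nbhs_ballP[e /= e0 He].
  have /cvgrPdist_lt /(_ e e0) [N _ HN] := cvg_peak r0 q0 q4.
  (* [N] brings the apex time within e of 0; the truncation makes j + 1 exceed the supposed constant
     |C| + 1. *)
  pose j := maxn N (Num.trunc (`|C| + 1)).
  have /= jN := HN j (leq_maxl _ _).
  have p0 := peak_gt0 q0 r00 j; have p1 := peak_lt1 q0 q4 r00 r01 j.
  have ph : 0 < phi (peak q r0 j) by apply: phi0; rewrite p0.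
  have /= := He (peak q r0 j) jN p0; apply/negP; rewrite -ltNge.
  have tp := le_trans (HK j) (tower_peak K q0 q4 r00 r01 ep0 j).
  rewrite (gtr0_norm ph); apply: (@lt_le_trans _ _ (j.+1%:R * phi (peak q r0 j))).
    rewrite ltr_pM2r// (lt_le_trans (truncnS_gt _))// ler_nat ltnS.
    exact: leq_maxr.
  by apply: (le_trans tp); exact: ler_norm.
Qed.
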